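(* Let $S$ be a sub-semifield of $\mathbb{T}$, let $K$ be a field with a valuation $K\to S$, let $\mathcal{M}$ be a toric monoid, and let $I$ be an ideal of $K[\mathcal{M}]$ whose variety $Y:=V(I)$ has no component contained in the toric boundary. Let $R$ be any localization of $S[\mathcal{M}]/\operatorname{Bend}(\operatorname{trop} I)$ by a set of cancellative elements, and let $A$ be any sub-semiring of $R$. Then the valuative integral closure and the quasi-integral closure of $A$ in $R$ agree: $\overline{A}^{\mathrm{V}}=\overline{A}^{\mathrm{Q}}$.
   Context: Semirings are commutative, with $0$ and $1$, satisfy $a\cdot 0=0$, and are additively idempotent ($a+a=a$); the order is $a\le b\iff a+b=b$. A semifield is a semiring whose nonzero elements form a group under multiplication. $\mathbb{T}$ is the tropical semifield: the set $\mathbb{R}\cup\{-\infty\}$ with maximum as addition and usual addition as multiplication, so $0_{\mathbb{T}}=-\infty$. A valuation $v:K\to S$ is a map with $v(a)=0_S\iff a=0$, $v(ab)=v(a)v(b)$, $v(1)=1_S$, $v(a+b)\le v(a)+v(b)$. A toric monoid is a monoid of the type arising in the study of normal (affine) toric varieties, i.e. of the form $\sigma^\vee\cap M$ for $M$ a finitely generated free abelian group and $\sigma$ a strongly convex rational polyhedral cone in $\operatorname{Hom}(M,\mathbb{Z})\otimes\mathbb{R}$. The toric boundary is the complement of the dense torus $\operatorname{Spec}K[M]$ in the affine toric variety $\operatorname{Spec}K[\mathcal{M}]$. Components of the variety $V(I)$ are its irreducible components. For $F=\sum_u c_u\chi^u\in K[\mathcal{M}]$, $\operatorname{trop}(F)=\sum_u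 v(c_u)\chi^u\in S[\mathcal{M}]$, and $\operatorname{trop}I$ is the ideal of $S[\mathcal{M}]$ generated by $\{\operatorname{trop}(F):F\in I\}$. For $f\in S[\mathcal{M}]$ and $i\in\operatorname{supp}(f)$ (the set of monomials occurring in $f$ with nonzero coefficient), let $f_{\hat\imath}$ be $f$ with the $i$ term deleted; the bend relations of $f$ are the pairs $(f,f_{\hat\imath})$, $i\in\operatorname{supp}(f)$. A congruence on a semiring is an equivalence relation respecting the operations; $\operatorname{Bend}(J)$ is the congruence on $S[\mathcal{M}]$ generated by the bend relations of all $f\in J$. An element $s\ne0$ of a semiring is cancellative if $sb=sc$ implies $b=c$; a semiring is cancellative if all its nonzero elements are. Localization by a set of cancellative elements means the semiring of fractions whose denominators are products of elements of that set; the total semiring of fractions of a semiring is its localization by all of its cancellative elements. Let $A\langle x\rangle$ be the smallest downward-closed sub-semiring of $R$ containing $A$ and $x$ (a subset $D$ is downward-closed if $x\le y\in D$ implies $x\in D$). An element $x\in R$ is quasi-integral over $A$ if there is an $A\langle x\rangle$-module $N\subseteq R$ that is the downward closure of a finitely generated $A$-module $L\subseteq N$ and that is faithful as an $A\langle x\rangle$-module (if $a,b\in A\langle x\rangle$ satisfy $an=bn$ for all $n\in N$, then $a=b$). $\overline{A}^{\mathrm{Q}}$ is the set of elements of $R$ quasi-integral over $A$. A proper congruence $P$ on $R$ is prime if $R/P$ is totally ordered and cancellative; $\kappa(P)$ is the total semiring of fractions of $R/P$, $|x|_P$ is the image of $x$ in $\kappa(P)$, and $R_P=\{x\in R:|x|_P\le1_{\kappa(P)}\}$.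 $\overline{A}^{\mathrm{V}}$ is the intersection of all $R_P$ over prime congruences $P$ on $R$ with $A\subseteq R_P$. *)

(* Defs.v *)
From HB Require Import structures.
From mathcomp Require Import all_boot all_order all_algebra finmap ring.
From mathcomp Require Import boolp classical_sets reals.

Set Implicit Arguments.
Unset Strict Implicit.
Unset Printing Implicit Defensive.

Import Order.TTheory GRing.Theory Num.Theory.

Local Open Scope quotient_scope.
Local Open Scope classical_set_scope.
Local Open Scope ring_scope.

Section SemiRings.
Variable R : comPzSemiRingType.
Implicit Types (A B D I J L N : set R) (x y : R).

(* This is a partial order only when [R] is additively idempotent, as are all
   semirings to which it is applied below. *)
Definition sle x y : Prop := x + y = y.

Definition totally_ordered : Prop := forall x y, sle x y \/ sle y x.

Definition cancellative_elt x : Prop :=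
  x <> 0 /\ forall y z, x * y = x * z -> y = z.

Definition cancellative : Prop := forall x, x <> 0 -> cancellative_elt x.

Definition semifield : Prop :=
  1 <> 0 :> R /\ forall x, x <> 0 -> exists y, x * y = 1.

(* Over a ring these are the usual ideals, since [- x = (- 1) * x]; the unit
   ideal is allowed. *)
Definition ideal I : Prop :=
  [/\ I 0, forall x y, I x -> I y -> I (x + y) & forall a x, I x -> I (a * x)].

Definition ideal_gen B : set R :=
  [set x | forall J, ideal J -> B `<=` J -> J x].

Definition subsemiring A : Prop :=
  [/\ A 0, A 1, forall x y, A x -> A y -> A (x + y)
    & forall x y, A x -> A y -> A (x * y)].

Definition submodule A L : Prop :=
  [/\ L 0, forall x y, L x -> L y -> L (x + y)
    & forall a x, A a -> L x -> L (a * x)].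

Definition module_gen A B : set R :=
  [set x | forall L, submodule A L -> B `<=` L -> L x].

Definition finitely_generated A L : Prop :=
  exists s : seq R, L = module_gen A [set x | x \in s].

Definition down_closed D : Prop := forall x y, sle x y -> D y -> D x.

Definition down_closure L : set R := [set x | exists2 y, L y & sle x y].

Record congruence := Congruence {
  cong_rel :> R -> R -> Prop;
  cong_refl : forall x, cong_rel x x;
  cong_sym : forall x y, cong_rel x y -> cong_rel y x;
  cong_trans : forall x y z, cong_rel x y -> cong_rel y z -> cong_rel x z;
  cong_add : forall x x' y y',
    cong_rel x x' -> cong_rel y y' -> cong_rel (x + y) (x' + y');
  cong_mul : forall x x' y y',
    cong_rel x x' -> cong_rel y y' -> cong_rel (x * y) (x' * y') }.

Section Generated.
Variable E : R -> R -> Prop.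

Definition cong_gen_rel x y : Prop :=
  forall C : congruence, (forall a b, E a b -> C a b) -> C x y.

Fact cong_gen_refl x : cong_gen_rel x x.
Proof. by move=> C _; apply: cong_refl. Qed.

Fact cong_gen_sym x y : cong_gen_rel x y -> cong_gen_rel y x.
Proof. by move=> h C hC; apply/cong_sym/h. Qed.

Fact cong_gen_trans x y z :
  cong_gen_rel x y -> cong_gen_rel y z -> cong_gen_rel x z.
Proof. by move=> h k C hC; apply: (cong_trans (h C hC) (k C hC)). Qed.

Fact cong_gen_add x x' y y' :
  cong_gen_rel x x' -> cong_gen_rel y y' -> cong_gen_rel (x + y) (x' + y').
Proof. by move=> h k C hC; apply: cong_add; [apply: h|apply: k]. Qed.

Fact cong_gen_mul x x' y y' :
  cong_gen_rel x x' -> cong_gen_rel y y' -> cong_gen_rel (x * y) (x' * y').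
Proof. by move=> h k C hC; apply: cong_mul; [apply: h|apply: k]. Qed.

Definition cong_gen : congruence :=
  Congruence cong_gen_refl cong_gen_sym cong_gen_trans
             cong_gen_add cong_gen_mul.
End Generated.

End SemiRings.

Section QuotientSemiRing.
Variables (R : comPzSemiRingType) (P : congruence R).

Definition cong_bool (x y : R) : bool := `[< P x y >].

Fact cong_bool_equiv : equiv_class_of cong_bool.
Proof.
split=> [x|x y|y x z].
- exact/asboolP/cong_refl.
- by apply/asboolP/asboolP => /cong_sym.
- by move=> /asboolP h /asboolP k; apply/asboolP/(cong_trans h k).
Qed.

Canonical cong_equiv_rel := EquivRelPack cong_bool_equiv.
Canonical cong_encModRel := defaultEncModRel cong_bool.

Definition quotient := {eq_quot cong_bool}.

HB.instance Definition _ : EqQuotient R cong_bool quotient :=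
  EqQuotient.on quotient.
HB.instance Definition _ := Choice.on quotient.

Definition quot_pi (x : R) : quotient := \pi_quotient x.

Lemma quot_piP x y : quot_pi x = quot_pi y <-> P x y.
Proof.
by split=> [/eqmodP/asboolP|h] //; apply/eqmodP/asboolP.
Qed.

Lemma quot_piK (x : quotient) : quot_pi (repr x) = x.
Proof. exact: reprK. Qed.

Lemma quot_repr x : P (repr (quot_pi x)) x.
Proof. by apply/quot_piP; rewrite quot_piK. Qed.

Definition quot_add (x y : quotient) : quotient := quot_pi (repr x + repr y).
Definition quot_mul (x y : quotient) : quotient := quot_pi (repr x * repr y).

Lemma quot_addE x y : quot_add (quot_pi x) (quot_pi y) = quot_pi (x + y).
Proof. by apply/quot_piP/cong_add; apply: quot_repr. Qed.

Lemma quot_mulE x y : quot_mul (quot_pi x) (quot_pi y) = quot_pi (x * y).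
Proof. by apply/quot_piP/cong_mul; apply: quot_repr. Qed.

Fact quot_addA : associative quot_add.
Proof.
by move=> x y z; rewrite -(quot_piK x) -(quot_piK y) -(quot_piK z)
  !quot_addE addrA.
Qed.

Fact quot_addC : commutative quot_add.
Proof.
by move=> x y; rewrite -(quot_piK x) -(quot_piK y) !quot_addE addrC.
Qed.

Fact quot_add0 : left_id (quot_pi 0) quot_add.
Proof. by move=> x; rewrite -(quot_piK x) quot_addE add0r. Qed.

HB.instance Definition _ :=
  GRing.isNmodule.Build quotient quot_addA quot_addC quot_add0.

Fact quot_mulA : associative quot_mul.
Proof.
by move=> x y z; rewrite -(quot_piK x) -(quot_piK y) -(quot_piK z)
  !quot_mulE mulrA.
Qed.

Fact quot_mulC : commutative quot_mul.
Proof.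
by move=> x y; rewrite -(quot_piK x) -(quot_piK y) !quot_mulE mulrC.
Qed.

Fact quot_mul1 : left_id (quot_pi 1) quot_mul.
Proof. by move=> x; rewrite -(quot_piK x) quot_mulE mul1r. Qed.

Fact quot_mulDl : left_distributive quot_mul quot_add.
Proof.
by move=> x y z; rewrite -(quot_piK x) -(quot_piK y) -(quot_piK z)
  !(quot_addE, quot_mulE) mulrDl.
Qed.

Fact quot_mul0 : left_zero (quot_pi 0) quot_mul.
Proof. by move=> x; rewrite -(quot_piK x) quot_mulE mul0r. Qed.

HB.instance Definition _ := GRing.Nmodule_isComPzSemiRing.Build quotient
  quot_mulA quot_mulC quot_mul1 quot_mulDl quot_mul0.

Fact quot_pi_additive : nmod_morphism quot_pi.
Proof. by split=> // x y; apply/esym/quot_addE. Qed.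

Fact quot_pi_multiplicative : monoid_morphism quot_pi.
Proof. by split=> // x y; apply/esym/quot_mulE. Qed.

HB.instance Definition _ :=
  GRing.isNmodMorphism.Build R quotient quot_pi quot_pi_additive.
HB.instance Definition _ :=
  GRing.isMonoidMorphism.Build R quotient quot_pi quot_pi_multiplicative.

End QuotientSemiRing.

Section Localization.
Variables (R : comPzSemiRingType) (U : set R).

Definition denominator : set R :=
  [set d | exists2 s : seq R, {in s, forall u, U u} & d = \prod_(u <- s) u].

Fact denominator1 : denominator 1.
Proof. by exists [::]; rewrite ?big_nil. Qed.

Fact denominatorM x y : denominator x -> denominator y -> denominator (x * y).
Proof.
move=> [s hs ->] [t ht ->]; exists (s ++ t); last by rewrite big_cat.
by move=> u; rewrite mem_cat => /orP[/hs|/ht].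
Qed.

Definition prefraction := {x : R * R | `[< denominator x.2 >]}.

Fact prefractionP (x : prefraction) : denominator (val x).2.
Proof. exact/asboolP/(valP x). Qed.

Definition mkfrac (x d : R) (hd : denominator d) : prefraction :=
  exist (fun x : R * R => `[< denominator x.2 >]) (x, d) (introT (asboolP _) hd).

(* The factor [w] makes this an equivalence relation for every [U]; it can be
   dropped when the elements of [U] are cancellative, see [frac_cancelP]. *)
Definition frac_rel (x y : prefraction) : Prop :=
  exists2 w, denominator w &
    w * ((val x).1 * (val y).2) = w * ((val y).1 * (val x).2).

Definition frac_bool (x y : prefraction) : bool := `[< frac_rel x y >].

Fact frac_bool_equiv : equiv_class_of frac_bool.
Proof.
split=> [x|x y|y x z].
- by apply/asboolP; exists 1; [apply: denominator1|].
- by apply/asboolP/asboolP => -[w hw e]; exists w.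
- move=> /asboolP[w hw e] /asboolP[w' hw' e']; apply/asboolP.
  exists (w * w' * (val y).2).
    by apply: denominatorM; [apply: denominatorM|apply: prefractionP].
  move: e e'; case: (val x) (val y) (val z) => [a d] [b f] [c g] /= e e'.
  have -> : w * w' * f * (a * g) = w * (a * f) * (w' * g) by ring.
  rewrite e; have -> : w * (b * d) * (w' * g) = w' * (b * g) * (w * d) by ring.
  by rewrite e'; ring.
Qed.

Canonical frac_equiv_rel := EquivRelPack frac_bool_equiv.
Canonical frac_encModRel := defaultEncModRel frac_bool.

Definition localization := {eq_quot frac_bool}.

HB.instance Definition _ : EqQuotient prefraction frac_bool localization :=
  EqQuotient.on localization.
HB.instance Definition _ := Choice.on localization.

Definition frac (x d : R) (hd : denominator d) : localization :=
  \pi_localization (mkfrac x hd).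

Lemma fracP x d hd y f hf : @frac x d hd = @frac y f hf <->
  exists2 w, denominator w & w * (x * f) = w * (y * d).
Proof. by split=> [/eqmodP/asboolP|h] //; apply/eqmodP/asboolP. Qed.

Lemma frac_cancelP x d hd y f hf :
  (forall u, U u -> cancellative_elt u) ->
  @frac x d hd = @frac y f hf <-> x * f = y * d.
Proof.
move=> hU; split=> [/fracP[_ [s hs ->]]|e]; last first.
  by apply/fracP; exists 1; [apply: denominator1|rewrite e].
elim: s hs => [|u s IH] hs; first by rewrite !big_nil !mul1r.
rewrite !big_cons -!mulrA => /(hU u (hs u (mem_head u s))).2; apply: IH.
by move=> t ht; apply: hs; rewrite inE ht orbT.
Qed.

Lemma frac_surj (z : localization) : exists x d hd, z = @frac x d hd.
Proof.
case: (repr z) (reprK z) => -[x d] hd <-; exists x, d, (elimT (asboolP _) hd).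
by congr (\pi_localization _); apply: val_inj.
Qed.

Definition loc_add (y z : localization) : localization :=
  frac ((val (repr y)).1 * (val (repr z)).2 + (val (repr z)).1 * (val (repr y)).2)
       (denominatorM (prefractionP (repr y)) (prefractionP (repr z))).

Definition loc_mul (y z : localization) : localization :=
  frac ((val (repr y)).1 * (val (repr z)).1)
       (denominatorM (prefractionP (repr y)) (prefractionP (repr z))).

Lemma frac_repr x d hd : exists2 w, denominator w &
  w * ((val (repr (@frac x d hd))).1 * d) = w * (x * (val (repr (@frac x d hd))).2).
Proof.
have /eqmodP/asboolP := reprK (@frac x d hd).
by case=> w hw /= e; exists w.
Qed.

Lemma loc_mulE x d hd y f hf : loc_mul (@frac x d hd) (@frac y f hf) =
  frac (x * y) (denominatorM hd hf).
Proof.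
apply/fracP; have [w hw e] := frac_repr x hd; have [w' hw' e'] := frac_repr y hf.
exists (w * w'); first exact: denominatorM.
move: e e'; set a := (val _).1; set a2 := (val _).2.
set b := (val (repr (frac y hf))).1; set b2 := (val (repr (frac y hf))).2.
move=> e e'; have -> : w * w' * (a * b * (d * f)) = (w * (a * d)) * (w' * (b * f)).
  by ring.
by rewrite e e'; ring.
Qed.

Lemma loc_addE x d hd y f hf : loc_add (@frac x d hd) (@frac y f hf) =
  frac (x * f + y * d) (denominatorM hd hf).
Proof.
apply/fracP; have [w hw e] := frac_repr x hd; have [w' hw' e'] := frac_repr y hf.
exists (w * w'); first exact: denominatorM.
move: e e'; set a := (val (repr (frac x hd))).1.
set a2 := (val (repr (frac x hd))).2; set b := (val (repr (frac y hf))).1.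
set b2 := (val (repr (frac y hf))).2 => e e'.
have -> : w * w' * ((a * b2 + b * a2) * (d * f)) =
    (w * (a * d)) * (w' * b2 * f) + (w' * (b * f)) * (w * a2 * d) by ring.
by rewrite e e'; ring.
Qed.

Fact loc_addA : associative loc_add.
Proof.
move=> x y z.
have [a [d [hd ->]]] := frac_surj x; have [b [f [hf ->]]] := frac_surj y.
have [c [g [hg ->]]] := frac_surj z; rewrite !loc_addE; apply/fracP.
exists 1; first exact: denominator1.
by ring.
Qed.

Fact loc_addC : commutative loc_add.
Proof.
move=> x y.
have [a [d [hd ->]]] := frac_surj x; have [b [f [hf ->]]] := frac_surj y.
rewrite !loc_addE; apply/fracP; exists 1; first exact: denominator1.
by ring.
Qed.

Fact loc_add0 : left_id (frac 0 denominator1) loc_add.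
Proof.
move=> x; have [a [d [hd ->]]] := frac_surj x.
rewrite !loc_addE; apply/fracP; exists 1; first exact: denominator1.
by ring.
Qed.

HB.instance Definition _ :=
  GRing.isNmodule.Build localization loc_addA loc_addC loc_add0.

Fact loc_mulA : associative loc_mul.
Proof.
move=> x y z.
have [a [d [hd ->]]] := frac_surj x; have [b [f [hf ->]]] := frac_surj y.
have [c [g [hg ->]]] := frac_surj z; rewrite !loc_mulE; apply/fracP.
by exists 1; [apply: denominator1|ring].
Qed.

Fact loc_mulC : commutative loc_mul.
Proof.
move=> x y.
have [a [d [hd ->]]] := frac_surj x; have [b [f [hf ->]]] := frac_surj y.
rewrite !loc_mulE; apply/fracP; exists 1; first exact: denominator1.
by ring.
Qed.

Fact loc_mul1 : left_id (frac 1 denominator1) loc_mul.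
Proof.
move=> x; have [a [d [hd ->]]] := frac_surj x.
rewrite !loc_mulE; apply/fracP; exists 1; first exact: denominator1.
by ring.
Qed.

Fact loc_mulDl : left_distributive loc_mul loc_add.
Proof.
move=> x y z.
have [a [d [hd ->]]] := frac_surj x; have [b [f [hf ->]]] := frac_surj y.
have [c [g [hg ->]]] := frac_surj z; rewrite !(loc_addE, loc_mulE).
apply/fracP; exists 1; first exact: denominator1.
by ring.
Qed.

Fact loc_mul0 : left_zero (frac 0 denominator1) loc_mul.
Proof.
move=> x; have [a [d [hd ->]]] := frac_surj x.
rewrite !loc_mulE; apply/fracP; exists 1; first exact: denominator1.
by ring.
Qed.

HB.instance Definition _ := GRing.Nmodule_isComPzSemiRing.Build localization
  loc_mulA loc_mulC loc_mul1 loc_mulDl loc_mul0.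

Definition loc_in (x : R) : localization := frac x denominator1.

Fact loc_in_additive : nmod_morphism loc_in.
Proof.
split=> // x y; rewrite [RHS]loc_addE; apply/fracP.
by exists 1; [apply: denominator1|ring].
Qed.

Fact loc_in_multiplicative : monoid_morphism loc_in.
Proof.
split=> // x y; rewrite [RHS]loc_mulE; apply/fracP.
by exists 1; [apply: denominator1|ring].
Qed.

HB.instance Definition _ :=
  GRing.isNmodMorphism.Build R localization loc_in loc_in_additive.
HB.instance Definition _ :=
  GRing.isMonoidMorphism.Build R localization loc_in loc_in_multiplicative.

End Localization.

Definition total_fractions (R : comPzSemiRingType) : comPzSemiRingType :=
  localization (@cancellative_elt R).

Section Closures.
Variable R : comPzSemiRingType.
Implicit Types (A N : set R) (x : R) (P : congruence R).

Definition proper_congruence P : Prop := ~ forall x y, P x y.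

Definition prime_congruence P : Prop :=
  [/\ proper_congruence P, totally_ordered (quotient P)
    & cancellative (quotient P)].

Definition residue P : comPzSemiRingType := total_fractions (quotient P).

Definition residue_abs P x : residue P :=
  loc_in (@cancellative_elt (quotient P)) (quot_pi P x).

Definition valuation_subsemiring P : set R :=
  [set x | sle (residue_abs P x) 1].

Definition valuative_closure A : set R :=
  [set x | forall P, prime_congruence P ->
     A `<=` valuation_subsemiring P -> valuation_subsemiring P x].

Definition down_adjoin A x : set R :=
  [set y | forall D, subsemiring D -> down_closed D ->
     A `<=` D -> D x -> D y].

Definition faithful A N : Prop :=
  forall a b, A a -> A b -> (forall n, N n -> a * n = b * n) -> a = b.

Definition quasi_integral A x : Prop :=
  exists N L : set R,
    [/\ submodule (down_adjoin A x) N,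
        submodule A L /\ finitely_generated A L,
        L `<=` N,
        N = down_closure L
      & faithful (down_adjoin A x) N].

Definition quasi_integral_closure A : set R := [set x | quasi_integral A x].

End Closures.

Section Tropical.
Variable R : realType.

(* [None] is minus infinity. *)
Definition tropical : Type := option R.

HB.instance Definition _ := Choice.on tropical.

Definition trop_add (x y : tropical) : tropical :=
  match x, y with
  | None, _ => y
  | _, None => x
  | Some a, Some b => Some (Num.max a b)
  end.

Definition trop_mul (x y : tropical) : tropical :=
  match x, y with
  | Some a, Some b => Some (a + b)
  | _, _ => None
  end.

Fact trop_addA : associative trop_add.
Proof. by move=> [a|] [b|] [c|] //=; rewrite maxA. Qed.

Fact trop_addC : commutative trop_add.
Proof. by move=> [a|] [b|] //=; rewrite maxC. Qed.

Fact trop_add0 : left_id None trop_add.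
Proof. by []. Qed.

HB.instance Definition _ :=
  GRing.isNmodule.Build tropical trop_addA trop_addC trop_add0.

Fact trop_mulA : associative trop_mul.
Proof. by move=> [a|] [b|] [c|] //=; rewrite addrA. Qed.

Fact trop_mulC : commutative trop_mul.
Proof. by move=> [a|] [b|] //=; rewrite addrC. Qed.

Fact trop_mul1 : left_id (Some 0) trop_mul.
Proof. by move=> [a|] //=; rewrite add0r. Qed.

Fact trop_mulDl : left_distributive trop_mul trop_add.
Proof. by move=> [a|] [b|] [c|] //=; rewrite addr_maxl. Qed.

Fact trop_mul0 : left_zero None trop_mul.
Proof. by []. Qed.

Fact trop_1_neq0 : Some 0 != None :> tropical.
Proof. by []. Qed.

HB.instance Definition _ := GRing.Nmodule_isComNzSemiRing.Build tropical
  trop_mulA trop_mulC trop_mul1 trop_mulDl trop_mul0 trop_1_neq0.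

End Tropical.

Definition valuation (K : fieldType) (S : comPzSemiRingType) (v : K -> S) :=
  [/\ forall a, v a = 0 <-> a = 0,
      forall a b, v (a * b) = v a * v b,
      v 1 = 1
    & forall a b, sle (v (a + b)) (v a + v b)].

Section MonoidAlgebra.
Variables (S : comPzSemiRingType) (M : nmodType).

(* The monoid [M] is written additively; [monom u c] is the term [c chi^u]. *)
Definition monalg : Type := {fsfun M -> S with 0}.

HB.instance Definition _ := Choice.on monalg.

Definition mcoef (f : monalg) (u : M) : S := f u.

Definition msupp (f : monalg) : {fset M} := finsupp f.

Lemma mem_msupp f u : (u \in msupp f) = (mcoef f u != 0).
Proof. exact: mem_finsupp. Qed.

Lemma mcoef_eq0 f u : u \notin msupp f -> mcoef f u = 0.
Proof. by rewrite mem_msupp negbK => /eqP. Qed.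

Lemma monalgP f g : (forall u, mcoef f u = mcoef g u) -> f = g.
Proof. by move=> h; apply/fsfunP. Qed.

Definition monom (u : M) (c : S) : monalg :=
  [fsfun w in [fset u]%fset => c | 0].

Definition mzero : monalg := [fsfun].

Definition madd (f g : monalg) : monalg :=
  [fsfun u in (msupp f `|` msupp g)%fset => mcoef f u + mcoef g u | 0].

Lemma mcoef_monom u c w : mcoef (monom u c) w = if w == u then c else 0.
Proof. by rewrite /mcoef fsfun_fun inE. Qed.

Lemma mcoef_zero u : mcoef mzero u = 0.
Proof. by rewrite /mcoef fsfun0E. Qed.

Lemma mcoef_add f g u : mcoef (madd f g) u = mcoef f u + mcoef g u.
Proof.
rewrite [LHS]fsfun_fun in_fsetU; case: ifPn => // /norP[hf hg].
by rewrite !mcoef_eq0 // addr0.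
Qed.

Fact maddA : associative madd.
Proof. by move=> f g h; apply: monalgP => u; rewrite !mcoef_add addrA. Qed.

Fact maddC : commutative madd.
Proof. by move=> f g; apply: monalgP => u; rewrite !mcoef_add addrC. Qed.

Fact madd0 : left_id mzero madd.
Proof.
by move=> f; apply: monalgP => u; rewrite mcoef_add mcoef_zero add0r.
Qed.

HB.instance Definition _ := GRing.isNmodule.Build monalg maddA maddC madd0.

Lemma mcoef0 u : mcoef 0 u = 0. Proof. exact: mcoef_zero. Qed.

Lemma mcoefD f g u : mcoef (f + g) u = mcoef f u + mcoef g u.
Proof. exact: mcoef_add. Qed.

Lemma mcoef_sum (I : Type) (r : seq I) (Q : pred I) (F : I -> monalg) u :
  mcoef (\sum_(i <- r | Q i) F i) u = \sum_(i <- r | Q i) mcoef (F i) u.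
Proof.
by apply: (big_morph (mcoef^~ u)) => [f g|]; rewrite ?mcoefD ?mcoef0.
Qed.

Lemma monom0 u : monom u 0 = 0.
Proof.
by apply: monalgP => w; rewrite mcoef_monom mcoef0 if_same.
Qed.

Lemma monomD u c d : monom u (c + d) = monom u c + monom u d.
Proof.
apply: monalgP => w; rewrite mcoefD !mcoef_monom.
by case: eqP => // _; rewrite addr0.
Qed.

Definition mmul (f g : monalg) : monalg :=
  \sum_(u <- msupp f) \sum_(w <- msupp g)
     monom (u + w) (mcoef f u * mcoef g w).

Lemma mmul_wide f g (X Y : {fset M}) :
  (msupp f `<=` X)%fset -> (msupp g `<=` Y)%fset ->
  mmul f g = \sum_(u <- X) \sum_(w <- Y) monom (u + w) (mcoef f u * mcoef g w).
Proof.
move=> hX hY; rewrite /mmul.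
have -> : \sum_(u <- msupp f) \sum_(w <- msupp g)
    monom (u + w) (mcoef f u * mcoef g w) =
  \sum_(u <- msupp f) \sum_(w <- Y) monom (u + w) (mcoef f u * mcoef g w).
  apply: eq_bigr => u _; apply: big_fset_incl => // w _ hw.
  by rewrite (mcoef_eq0 hw) mulr0 monom0.
apply: big_fset_incl => // u _ hu; apply: big1 => w _.
by rewrite (mcoef_eq0 hu) mul0r monom0.
Qed.

Lemma mmulC : commutative mmul.
Proof.
move=> f g; rewrite /mmul exchange_big; apply: eq_bigr => u _.
by apply: eq_bigr => w _; rewrite addrC mulrC.
Qed.

Lemma mmulDl : left_distributive mmul +%R.
Proof.
move=> f g h; set X := (msupp f `|` msupp g)%fset.
have hX : (msupp (f + g)%R `<=` X)%fset.
  apply/fsubsetP => u; rewrite !mem_msupp mcoefD in_fsetU !mem_msupp.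
  apply: contraNT; rewrite negb_or !negbK => /andP[/eqP-> /eqP->].
  by rewrite addr0.
rewrite (mmul_wide hX (fsubset_refl _)).
rewrite (mmul_wide (fsubsetUl _ (msupp g)) (fsubset_refl _)).
rewrite (mmul_wide (fsubsetUr (msupp f) _) (fsubset_refl _)) -big_split.
apply: eq_bigr => u _; rewrite -big_split; apply: eq_bigr => w _ /=.
by rewrite mcoefD mulrDl monomD.
Qed.

Lemma mmul0 : left_zero 0 mmul.
Proof.
move=> f; rewrite /mmul; apply: big1 => u _; apply: big1 => w _.
by rewrite mcoef0 mul0r monom0.
Qed.

Lemma mmulDr f g h : mmul f (g + h) = mmul f g + mmul f h.
Proof. by rewrite mmulC mmulDl !(mmulC f). Qed.

Lemma mmul_suml (I : Type) (r : seq I) (F : I -> monalg) g :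
  mmul (\sum_(i <- r) F i) g = \sum_(i <- r) mmul (F i) g.
Proof.
apply: (big_morph (mmul^~ g)); [by move=> *; apply: mmulDl|exact: mmul0].
Qed.

Lemma mmul_sumr (I : Type) (r : seq I) (F : I -> monalg) g :
  mmul g (\sum_(i <- r) F i) = \sum_(i <- r) mmul g (F i).
Proof.
by rewrite mmulC mmul_suml; apply: eq_bigr => i _; rewrite mmulC.
Qed.

Lemma msupp_monom u c : (msupp (monom u c) `<=` [fset u])%fset.
Proof.
apply/fsubsetP => w; rewrite mem_msupp mcoef_monom inE.
by case: ifP => //; rewrite eqxx.
Qed.

Lemma mmul_monom u c w d : mmul (monom u c) (monom w d) = monom (u + w) (c * d).
Proof.
rewrite (mmul_wide (msupp_monom _ _) (msupp_monom _ _)).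
by rewrite !big_seq_fset1 !mcoef_monom !eqxx.
Qed.

Lemma monalg_sum f : f = \sum_(u <- msupp f) monom u (mcoef f u).
Proof.
apply: monalgP => w; rewrite mcoef_sum.
under eq_bigr do rewrite mcoef_monom.
have [hw|hw] := boolP (w \in msupp f).
  rewrite (big_fsetD1 w hw) /= eqxx big1_seq ?addr0 // => u /=.
  by rewrite in_fsetD1 eq_sym => /andP[/negPf->].
rewrite mcoef_eq0 // big1_seq // => u /= hu.
by case: eqP hw => // ->; rewrite hu.
Qed.

Lemma mmulA : associative mmul.
Proof.
move=> f g h; rewrite (monalg_sum f) !mmul_suml; apply: eq_bigr => u _.
rewrite (monalg_sum g) mmul_suml !mmul_sumr mmul_suml; apply: eq_bigr => w _.
rewrite (monalg_sum h) !mmul_sumr; apply: eq_bigr => z _.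
by rewrite !mmul_monom addrA mulrA.
Qed.

Lemma mmul1 : left_id (monom 0 1) mmul.
Proof.
move=> f; rewrite {1}(monalg_sum f) mmul_sumr [RHS]monalg_sum.
by apply: eq_bigr => u _; rewrite mmul_monom add0r mul1r.
Qed.

HB.instance Definition _ := GRing.Nmodule_isComPzSemiRing.Build monalg
  mmulA mmulC mmul1 mmulDl mmul0.

End MonoidAlgebra.

Section Tropicalization.
Variables (K : fieldType) (S : comPzSemiRingType) (v : K -> S) (M : nmodType).

Definition trop (F : monalg K M) : monalg S M :=
  \sum_(u <- msupp F) monom u (v (mcoef F u)).

Definition trop_ideal (I : set (monalg K M)) : set (monalg S M) :=
  ideal_gen [set trop F | F in I].

Definition mdelete (f : monalg S M) (i : M) : monalg S M :=
  \sum_(u <- msupp f | u != i) monom u (mcoef f u).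

Definition bend_relation (J : set (monalg S M)) (f g : monalg S M) : Prop :=
  J f /\ exists2 i, i \in msupp f & g = mdelete f i.

Definition Bend (J : set (monalg S M)) : congruence (monalg S M) :=
  cong_gen (bend_relation J).

Definition bend_quotient (I : set (monalg K M)) : comPzSemiRingType :=
  quotient (Bend (trop_ideal I)).

End Tropicalization.

Section Spec.
Variable A : comPzSemiRingType.
Implicit Types (Y Z C : set (set A)).

(* The points of the spectrum are the prime ideals, viewed as subsets. *)
Definition prime_ideal (p : set A) : Prop :=
  [/\ ideal p, ~ p 1 & forall x y, p (x * y) -> p x \/ p y].

Definition Spec : set (set A) := [set p | prime_ideal p].

Definition zero_locus (J : set A) : set (set A) :=
  [set p | Spec p /\ J `<=` p].

Definition zariski_closed C : Prop := exists J, C = zero_locus J.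

Definition irreducible Z : Prop :=
  Z !=set0 /\ forall C D, zariski_closed C -> zariski_closed D ->
    Z `<=` C `|` D -> Z `<=` C \/ Z `<=` D.

Definition irreducible_component Y Z : Prop :=
  [/\ Z `<=` Y, irreducible Z
    & forall Z', Z' `<=` Y -> irreducible Z' -> Z `<=` Z' -> Z' = Z].

End Spec.

Section Toric.
Variables (R : realType) (n : nat).

(* A basis of the lattice is fixed, so that the lattice and its dual are Z^n and
   the cone lies in the dual tensored with the reals, that is R^n. *)
Definition pairing (u : 'rV[int]_n) (x : 'rV[R]_n) : R :=
  \sum_(i < n) (u 0 i)%:~R * x 0 i.

Definition rational_polyhedral (sigma : set 'rV[R]_n) : Prop :=
  exists (m : nat) (r : 'M[int]_(m, n)),
    sigma = [set x | exists2 c : 'rV[R]_m, forall k, 0 <= c 0 k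
                     & x = c *m map_mx intr r].

Definition strongly_convex (sigma : set 'rV[R]_n) : Prop :=
  forall x, sigma x -> sigma (- x) -> x = 0.

Definition dual_cone_monoid (sigma : set 'rV[R]_n) : set 'rV[int]_n :=
  [set u | forall x, sigma x -> 0 <= pairing u x].

(* [iota] identifies the commutative monoid [M] with the lattice points of
   the dual of some strongly convex rational polyhedral cone. *)
Definition toric_embedding (M : nmodType) (iota : {additive M -> 'rV[int]_n}) :=
  injective iota /\
  exists sigma : set 'rV[R]_n,
    [/\ rational_polyhedral sigma, strongly_convex sigma
      & range iota = dual_cone_monoid sigma].

End Toric.

Section ToricBoundary.
Variables (K : fieldType) (n : nat) (M : nmodType).
Variable iota : {additive M -> 'rV[int]_n}.

Definition lattice_map (F : monalg K M) : monalg K 'rV[int]_n :=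
  \sum_(u <- msupp F) monom (iota u) (mcoef F u).

(* The torus [Spec K[Z^n]] is identified with its image under the open
   immersion into [Spec K[M]] given by contraction of primes. *)
Definition dense_torus : set (set (monalg K M)) :=
  [set lattice_map @^-1` q | q in @Spec (monalg K 'rV[int]_n)].

Definition toric_boundary : set (set (monalg K M)) :=
  @Spec (monalg K M) `\` dense_torus.

End ToricBoundary.

Arguments toric_boundary K {n M} iota.

(* Main.v *)
Require Import Defs.
From HB Require Import structures.
From mathcomp Require Import all_boot all_order perm all_algebra.
From mathcomp Require Import finmap ring zify.
From mathcomp Require Import boolp classical_sets reals.

Set Implicit Arguments.
Unset Strict Implicit.
Unset Printing Implicit Defensive.

Import Order.TTheory GRing.Theory.
Local Open Scope classical_set_scope.
Local Open Scope ring_scope.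

(** Both inclusions reduce to inequalities [x * n <= a * n] with [a] in [A].

    If such an inequality holds with [1 <= n], the downward closure of [A n]
    contains [1], hence is faithful, and [x] is quasi-integral.  If none holds,
    then [1] lies outside the ideal of all elements below some [n] with
    [x * n <= a * n] ([integrality_ideal]).  A minimal prime [q] over this ideal
    becomes the kernel of a prime congruence: put the preorder generated by
    [a <= 1] for [a] in [A], by [i <= 0] for [i] in [q] and by cancellation of
    the elements outside [q]; it does not give [x <= 1], and a maximal
    compatible preorder with this property is total.  Hence [A] is bounded by
    [1] at the corresponding prime congruence while [x] is not.  This gives the
    inclusion of the valuative closure in the quasi-integral closure over every
    additively idempotent semiring.

    Conversely, a quasi-integral [x] satisfies [x * l <= a * l], where [l <> 0]
    is the sum of the generators of the module.  At a prime congruence [P] with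
    [|l| <> 0] this gives [|x| <= |a| <= 1] by cancellation; the difficulty is
    that [l] may vanish at [P].  After clearing denominators, the inequality
    lives in the bend quotient, where an inequality [c chi^u <= g] always comes
    from a congruence [chi^u = G] modulo [I] with [c trop G <= g]
    ([bend_dominated]).  If [|x| > |a|], pick a term [s chi^u] of [x] with
    [|s chi^u| > |a|].  Applied to each term [l_i chi^(w_i)] of [l], the previous
    fact yields a system [chi^u chi^(w_i) = \sum_j E_ij chi^(w_j)] modulo [I],
    whose coefficients satisfy [s l_i trop E_ij <= l_j a].  By Cramer's rule
    [H = \det (chi^u - E)] satisfies [H chi^(w_j) \in I], and since the factors
    [l_j / l_i] cancel along permutations, [H] is a monomial plus terms that are
    strictly smaller at [P] ([dominant_term_det]).  Such elements form a
    multiplicative set disjoint from [I], so some minimal prime over [I]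
    contains none of them.  It does not contain [chi^(w_j)] either, because no
    component of the variety of [I] lies in the toric boundary: a
    contradiction. *)

(** * Zorn's lemma and minimal primes *)

Lemma zorn_above (T : Type) (Q : set T -> Prop) (X0 : set T) :
  Q X0 ->
  (forall F : set (set T), F !=set0 -> (forall X, F X -> X0 `<=` X /\ Q X) ->
     total_on F subset -> Q (\bigcup_(X in F) X)) ->
  exists2 X, X0 `<=` X /\ Q X & forall Y, X `<=` Y -> Q Y -> Y = X.
Proof.
move=> Q0 Qchain.
have [F FQ Ftot|X [QX Xmax]] := @Zorn_bigcup T [set X | Q (X0 `|` X)].
  have [->|/set0P[X1 FX1]] := eqVneq F set0.
    by rewrite /= bigcup_set0 setU0.
  rewrite /=; have -> : X0 `|` \bigcup_(X in F) X =
      \bigcup_(X in [set X0 `|` X | X in F]) X.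
    apply/seteqP; split=> [t [h|[X FX Xt]]|t [_ [X FX <-]] [h|h]].
    - by exists (X0 `|` X1); [exists X1|left].
    - by exists (X0 `|` X); [exists X|right].
    - by left.
    - by right; exists X.
  apply: Qchain.
  - by exists (X0 `|` X1), X1.
  - by move=> _ [X FX <-]; split; [left|apply: FQ].
  - move=> _ _ [X FX <-] [Y FY <-].
    by have [h|h] := Ftot X Y FX FY; [left|right]; apply: setUS.
exists (X0 `|` X) => [|Y XY QY]; first by split; [left|].
have [h|/eqP h] := eqVneq Y (X0 `|` X) => //.
have X0Y : X0 `<=` Y by move=> t ht; apply: XY; left.
have XY' : X `<=` Y by move=> t ht; apply: XY; right.
have QY' : Q (X0 `|` Y) by rewrite setUidr.
have [YX|nYX] := pselect (Y `<=` X); last by case: (Xmax Y).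
by case: h; apply/seteqP; split=> // t /YX ht; right.
Qed.

Section PrimeIdeals.
Variable R : comPzSemiRingType.
Implicit Types (J D W q : set R) (f g u w : R).

Lemma ideal_exprD J f g u m k : ideal J ->
  J (u * f ^+ m) -> J (u * g ^+ k) -> J (u * (f + g) ^+ (m + k)).
Proof.
move=> [J0 JD JM]; elim: m k u => [|m IHm] k u.
  by rewrite mulr1 => Ju _; rewrite mulrC; apply: JM.
elim: k u => [|k IHk] u Jf Jg.
  by rewrite mulrC; apply: JM; move: Jg; rewrite mulr1.
have -> : u * (f + g) ^+ (m.+1 + k.+1) =
    u * f * (f + g) ^+ (m + k.+1) + u * g * (f + g) ^+ (m.+1 + k).
  by rewrite addSnnS addnS exprS -addSnnS; ring.
apply: JD.
  apply: IHm; first by move: Jf; rewrite exprS mulrA.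
  by have := JM f _ Jg; congr J; ring.
apply: IHk; last by move: Jg; rewrite exprS mulrA.
by have := JM g _ Jf; congr J; ring.
Qed.

(** The complement of [q] is a maximal multiplicative set containing [D] and
    missing [J]; maximality makes every [f] in [q] nilpotent modulo [J] after
    multiplication by an element outside [q]. *)
Lemma minimal_prime J D : ideal J -> D 1 ->
  (forall f g, D f -> D g -> D (f * g)) -> (forall f, D f -> ~ J f) ->
  exists q, [/\ prime_ideal q, J `<=` q, forall f, D f -> ~ q f,
    forall f, q f -> exists w m, ~ q w /\ J (w * f ^+ m)
    & forall q', prime_ideal q' -> J `<=` q' -> q' `<=` q -> q' = q].
Proof.
move=> Jid D1 DM DJ; have [J0 JD JM] := Jid.
pose Q W := (forall f g, W f -> W g -> W (f * g)) /\ (forall f, W f -> ~ J f).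
have [|F [X1 FX1] FQ Ftot|W [DW [WM WJ]] Wmax] := @zorn_above R Q D.
- by split.
- split=> [f g [X FX Xf] [Y FY Yg]|f [X /FQ[_ [_ XJ]] /XJ]] //.
  have [h|h] := Ftot X Y FX FY.
    by exists Y => //; have [_ [YM _]] := FQ Y FY; apply: YM => //; apply: h.
  by exists X => //; have [_ [XM _]] := FQ X FX; apply: XM => //; apply: h.
have W1 : W 1 by apply: DW.
have WX f m : W f -> W (f ^+ m).
  by move=> Wf; elim: m => [|m IH]; [|rewrite exprS; apply: WM].
have outW f : ~ W f -> exists w m, W w /\ J (w * f ^+ m).
  move=> nWf; apply/not_existsP => h.
  pose Y := [set u | exists w m, W w /\ u = w * f ^+ m].
  have : Y = W.
    apply: Wmax => [w Ww|]; first by exists w, 0%N; rewrite mulr1.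
    split=> [_ _ [w [m [Ww ->]]] [w' [m' [Ww' ->]]]|_ [w [m [Ww ->]]] Jf].
      by exists (w * w'), (m + m')%N; split; [apply: WM|rewrite exprD; ring].
    by apply: (h w); exists m.
  move=> YW; apply: nWf; rewrite -YW; exists 1, 1%N.
  by rewrite mul1r.
have WMl f g : W (f * g) -> W g.
  move=> Wfg; apply: contrapT => /outW[w [m [Ww Jw]]].
  apply: (WJ (w * (f * g) ^+ m)); first by apply: WM => //; apply: WX.
  by rewrite exprMn mulrCA; apply: JM.
exists (~` W); split.
- split=> [|nW1|f g nWfg]; last 2 first.
  + exact: nW1.
  + apply: contrapT => /not_orP[/contrapT Wf /contrapT Wg].
    by apply: nWfg; apply: WM.
  split=> [/WJ//|f g|a f nWf /WMl//].
  move=> /outW[w [m [Ww Jw]]] /outW[w' [m' [Ww' Jw']]] Wfg.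
  apply: (WJ (w * w' * (f + g) ^+ (m + m'))).
    by apply: (WM); [apply: (WM)|apply: WX].
  apply: ideal_exprD => //; last by rewrite -mulrA; apply: JM.
  by rewrite mulrAC mulrC; apply: JM.
- by move=> f Jf /WJ.
- by move=> f /DW Wf nWf.
- by move=> f /outW[w [m [Ww Jw]]]; exists w, m; split.
- move=> q' [[q0 qD qM] q1 qP] Jq' q'q; apply/seteqP; split=> // f nWf.
  apply: contrapT => nqf; apply: nWf; suff <- : ~` q' = W by [].
  apply: Wmax; first by move=> w Ww /q'q; apply.
  by split=> [g h ng nh /qP[]//|g ng /Jq'].
Qed.

End PrimeIdeals.

(** * Idempotent semirings: valuative elements are quasi-integral *)

Section Idempotent.
Variable R : comPzSemiRingType.
Hypothesis idem : forall x : R, x + x = x.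
Implicit Types (A N : set R) (a b f g h k l n x y : R).

Lemma slexx x : sle x x. Proof. exact: idem. Qed.

Lemma sle0 x : sle 0 x. Proof. exact: add0r. Qed.

Lemma sle_trans y x z : sle x y -> sle y z -> sle x z.
Proof. by rewrite /sle => xy <-; rewrite addrA xy. Qed.

Lemma sle_anti x y : sle x y -> sle y x -> x = y.
Proof. by rewrite /sle => xy; rewrite addrC xy. Qed.

Lemma sle_addl x y : sle x (x + y).
Proof. by rewrite /sle addrA idem. Qed.

Lemma sle_addr x y : sle y (x + y).
Proof. by rewrite addrC; apply: sle_addl. Qed.

Lemma sle_lub x y z : sle x z -> sle y z -> sle (x + y) z.
Proof. by rewrite /sle => xz yz; rewrite -addrA yz. Qed.

Lemma sle_add x y z t : sle x y -> sle z t -> sle (x + z) (y + t).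
Proof.
by move=> xy zt; apply: sle_lub; [apply: sle_trans xy _; apply: sle_addl
  |apply: sle_trans zt _; apply: sle_addr].
Qed.

Lemma sle_mul2l z x y : sle x y -> sle (z * x) (z * y).
Proof. by rewrite /sle -mulrDr => ->. Qed.

Lemma sle_mul2r z x y : sle x y -> sle (x * z) (y * z).
Proof. by rewrite /sle -mulrDl => ->. Qed.

Lemma sle_mul x y z t : sle x y -> sle z t -> sle (x * z) (y * t).
Proof. by move=> xy zt; apply: sle_trans (sle_mul2l _ zt); apply: sle_mul2r. Qed.

Lemma sle_exp x y m : sle x y -> sle (x ^+ m) (y ^+ m).
Proof.
move=> xy; elim: m => [|m IH]; first exact: slexx.
by rewrite !exprS; apply: sle_mul.
Qed.

Lemma sle0_eq0 x : sle x 0 -> x = 0.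
Proof. by move=> h; apply: sle_anti h (sle0 x). Qed.

Lemma sle_sum (I : eqType) (r : seq I) (F : I -> R) y :
  {in r, forall i, sle (F i) y} -> sle (\sum_(i <- r) F i) y.
Proof.
move=> Fy; rewrite big_seq; elim/big_rec: _ => [|i z /Fy]; first exact: sle0.
exact: sle_lub.
Qed.

Lemma sle_sumr (I : eqType) (r : seq I) (F : I -> R) i :
  i \in r -> sle (F i) (\sum_(j <- r) F j).
Proof.
elim: r => // j r IH; rewrite inE big_cons => /orP[/eqP->|/IH h].
  exact: sle_addl.
exact: sle_trans h (sle_addr _ _).
Qed.

(** The module witnessing quasi-integrality is the downward closure of [A n];
    it is faithful because it contains [1]. *)
Lemma bounded_quasi_integral A x n a : subsemiring A ->
  A a -> sle 1 n -> sle (x * n) (a * n) -> quasi_integral A x.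
Proof.
move=> [A0 A1 AD AM] Aa n1 xn.
pose L := [set y | exists2 b, A b & y = b * n].
have Lmod : submodule A L.
  split=> [|_ _ [b Ab ->] [c Ac ->]|b _ Ab [c Ac ->]].
  - by exists 0; rewrite ?mul0r.
  - by exists (b + c); rewrite ?mulrDl //; apply: AD.
  - by exists (b * c); rewrite ?mulrA //; apply: AM.
have adjN d : down_adjoin A x d -> exists2 b, A b & sle (d * n) (b * n).
  move=> /(_ [set d | exists2 b, A b & sle (d * n) (b * n)]); apply.
  - split=> [||d' e [b Ab db] [c Ac ec]|d' e [b Ab db] [c Ac ec]].
    + by exists 0 => //; apply: slexx.
    + by exists 1 => //; apply: slexx.
    + by exists (b + c); rewrite ?mulrDl; [apply: AD|apply: sle_add].
    + exists (c * b); rewrite -?mulrA; first exact: AM.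
      apply: sle_trans (sle_mul2l d' ec) _.
      by rewrite mulrCA; apply: sle_mul2l.
  - move=> d' e de [b Ab eb]; exists b => //.
    by apply: sle_trans eb; apply: sle_mul2r.
  - by move=> b Ab; exists b => //; apply: slexx.
  - by exists a.
exists (down_closure L), L; split=> //.
- split=> [|y z [b Lb yb] [c Lc zc]|d y /adjN[b Ab db] [_ [c Ac ->] yc]].
  + by exists 0; [case: Lmod|apply: slexx].
  + by exists (b + c); [case: Lmod => _ + _; apply|apply: sle_add].
  + exists (c * b * n); first by exists (c * b) => //; apply: AM.
    apply: sle_trans (sle_mul2l d yc) _.
    by rewrite mulrCA -mulrA; apply: sle_mul2l.
- split=> //; exists [:: n]; apply/seteqP; split=> [_ [b Ab ->] L'|].
    by move=> [_ _ L'M] sL'; apply: L'M => //; apply: sL'; rewrite /= inE.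
  move=> y; apply=> // z; rewrite /= inE => /eqP->.
  by exists 1; rewrite ?mul1r.
- by move=> y Ly; exists y => //; apply: slexx.
- move=> d e _ _ /(_ 1); rewrite !mulr1; apply.
  by exists n => //; exists 1; rewrite ?mul1r.
Qed.

(** Inequalities that are preserved by the semiring operations and that allow
    the cancellation of elements outside [q], as do the inequalities at a prime
    congruence with kernel [q]. *)
Definition compatible_preorder (q : set R) (E : set (R * R)) :=
  [/\ forall f g h, E (f, g) -> E (g, h) -> E (f, h),
      forall f g h, E (f, h) -> E (g, h) -> E (f + g, h),
      forall f g h, E (f, g) -> E (h * f, h * g)
    & forall f g w, ~ q w -> E (w * f, w * g) -> E (f, g)].

Section MaximalPreorder.
Variables (E : set (R * R)) (q : set R) (x : R).
Hypotheses (q_prime : prime_ideal q)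
  (q_down : forall f g, sle f g -> q g -> q f).
Hypotheses (E_pre : compatible_preorder q E)
  (E_le : forall f g, sle f g -> E (f, g))
  (E_q : forall f, q f -> E (f, 0)) (E_x : ~ E (x, 1)).
Hypothesis E_max : forall E', E `<=` E' -> compatible_preorder q E' ->
  ~ E' (x, 1) -> E' = E.

(** With [g] inverted, imposing [f <= g] amounts to imposing
    [(f + g) / g <= 1], so that [h <= k] becomes [h <= ((f + g) / g)^m k] for
    some [m]; by maximality [x <= 1] must then follow. *)
Lemma maximal_preorder_adjoin f g : ~ E (f, g) ->
  exists m, E (x * g ^+ m, (f + g) ^+ m).
Proof.
move=> nE; have [Etr ED EM Ecanc] := E_pre.
pose E' := [set hk : R * R | exists m, E (hk.1 * g ^+ m, (f + g) ^+ m * hk.2)].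
have Ege m h k : E (h * g ^+ m, (f + g) ^+ m * k) ->
    forall m', (m <= m')%N -> E (h * g ^+ m', (f + g) ^+ m' * k).
  move=> Em m' /subnK <-; apply: (Etr _ (g ^+ (m' - m) * ((f + g) ^+ m * k))).
    by have := EM _ _ (g ^+ (m' - m)) Em; congr (E (_, _)); rewrite exprD; ring.
  rewrite exprD -mulrA; apply/E_le/sle_mul2r/sle_exp; exact: sle_addr.
have [//|nE'] := pselect (E' (x, 1)); last first.
  case: nE; suff <- : E' = E.
    exists 1%N; rewrite !expr1 /=; apply/E_le/sle_mul2r; exact: sle_addl.
  apply: E_max => //.
    by move=> [h k] Ehk; exists 0%N; rewrite mulr1 mul1r.
  split=> /=.
  - move=> h k l [m /= Em] [m' /= Em']; exists (m + m')%N => /=.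
    apply: (Etr _ ((f + g) ^+ m * k * g ^+ m')).
      by have := EM _ _ (g ^+ m') Em; congr (E (_, _)); rewrite ?exprD; ring.
    by have := EM _ _ ((f + g) ^+ m) Em'; congr (E (_, _)); rewrite ?exprD; ring.
  - move=> h k l [m /= Em] [m' /= Em']; exists (maxn m m') => /=.
    rewrite mulrDl; apply: ED; first exact: Ege Em _ (leq_maxl _ _).
    exact: Ege Em' _ (leq_maxr _ _).
  - move=> h k l [m /= Em]; exists m => /=.
    by have := EM _ _ l Em; congr (E (_, _)); ring.
  - move=> h k w qw [m /= Em]; exists m => /=; apply: (Ecanc _ _ w qw).
    by move: Em; congr (E (_, _)); ring.
by move=> [m /= Em]; exists m; move: Em; rewrite mulr1.
Qed.

(** If neither [f <= g] nor [g <= f] held, imposing either of them would give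
    [x <= 1], hence [x g^m <= (f + g)^m] and [x f^m' <= (f + g)^m'].  Every
    monomial of [(f + g)^(m' + m)] is divisible by [f^m'] or by [g^m], so that
    [x (f + g)^(m' + m) <= (f + g)^(m' + m)], and [f + g] can be cancelled. *)
Lemma maximal_preorder_total f g : E (f, g) \/ E (g, f).
Proof.
have [Etr ED EM Ecanc] := E_pre; have [[q0 qD qM] q1 qP] := q_prime.
have [qf|qf] := pselect (q f).
  by left; apply: Etr (E_q qf) _; apply/E_le/sle0.
have [qg|qg] := pselect (q g).
  by right; apply: Etr (E_q qg) _; apply/E_le/sle0.
apply: contrapT => /not_orP[nfg ngf]; apply: E_x.
have [m Eg] := maximal_preorder_adjoin nfg.
have [m' Ef] := maximal_preorder_adjoin ngf.
move: Ef; rewrite (addrC g) => Ef; set s := f + g in Eg Ef.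
have Es b c i j m0 : E (x * b ^+ m0, s ^+ m0) -> sle b s -> sle c s ->
    (m0 <= i)%N -> E (x * (b ^+ i * c ^+ j), s ^+ (i + j)).
  move=> Eb bs cs /subnK <-.
  apply: (Etr _ (b ^+ (i - m0) * c ^+ j * s ^+ m0)).
    have := EM _ _ (b ^+ (i - m0) * c ^+ j) Eb.
    by congr (E (_, _)); rewrite exprD; ring.
  have -> : s ^+ (i - m0 + m0 + j) = s ^+ (i - m0) * s ^+ j * s ^+ m0.
    by rewrite !exprD; ring.
  by apply/E_le/sle_mul2r/sle_mul; apply: sle_exp.
have Emix r i j : (i + j + r = m' + m)%N ->
    E (x * (f ^+ i * g ^+ j * s ^+ r), s ^+ (m' + m)).
  elim: r i j => [|r IH] i j ijr.
    rewrite mulr1 -ijr addn0; have [le_m'i|lt_im'] := leqP m' i.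
      by apply: Es Ef _ _ le_m'i; [apply: sle_addl|apply: sle_addr].
    rewrite (mulrC (f ^+ i)) addnC.
    apply: Es Eg _ _ _; [exact: sle_addr|exact: sle_addl|lia].
  have -> : x * (f ^+ i * g ^+ j * s ^+ r.+1) =
      x * (f ^+ i.+1 * g ^+ j * s ^+ r) + x * (f ^+ i * g ^+ j.+1 * s ^+ r).
    by rewrite !exprS /s; ring.
  by apply: ED; apply: IH; lia.
have qs : ~ q s by move=> qs; apply: qf; apply: q_down qs; apply: sle_addl.
have qX i : ~ q (s ^+ i).
  elim: i => [|i IH]; first by rewrite expr0.
  by rewrite exprS => /qP[].
apply: (Ecanc _ _ (s ^+ (m' + m))) => //.
by have := Emix (m' + m)%N 0%N 0%N erefl; rewrite !mul1r mulr1 mulrC.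
Qed.

Let Eeq f g := E (f, g) /\ E (g, f).

Fact preorder_refl f : Eeq f f.
Proof. by split; apply/E_le/slexx. Qed.

Fact preorder_sym f g : Eeq f g -> Eeq g f.
Proof. by case. Qed.

Fact preorder_trans f g h : Eeq f g -> Eeq g h -> Eeq f h.
Proof.
have [Etr _ _ _] := E_pre.
by move=> [fg gf] [gh hg]; split; [apply: Etr fg gh|apply: Etr hg gf].
Qed.

Fact preorder_add f f' g g' : Eeq f f' -> Eeq g g' -> Eeq (f + g) (f' + g').
Proof.
have [Etr ED _ _] := E_pre.
move=> [ff' f'f] [gg' g'g]; split; apply: ED.
- by apply: Etr ff' _; apply/E_le/sle_addl.
- by apply: Etr gg' _; apply/E_le/sle_addr.
- by apply: Etr f'f _; apply/E_le/sle_addl.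
- by apply: Etr g'g _; apply/E_le/sle_addr.
Qed.

Fact preorder_mul f f' g g' : Eeq f f' -> Eeq g g' -> Eeq (f * g) (f' * g').
Proof.
have [Etr _ EM _] := E_pre.
move=> [ff' f'f] [gg' g'g]; split.
  by apply: Etr (EM _ _ f gg') _; rewrite ![_ * g']mulrC; apply: EM.
by apply: Etr (EM _ _ f' g'g) _; rewrite ![_ * g]mulrC; apply: EM.
Qed.

Definition preorder_congruence : congruence R :=
  Congruence preorder_refl preorder_sym preorder_trans preorder_add preorder_mul.

Lemma preorder_congruence_sle f g :
  sle (quot_pi preorder_congruence f) (quot_pi preorder_congruence g) <->
  E (f, g).
Proof.
have [Etr ED _ _] := E_pre.
rewrite /sle -rmorphD /=; split=> [/quot_piP[h _]|Efg].
  by apply: Etr h; apply/E_le/sle_addl.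
apply/quot_piP; split; last exact/E_le/sle_addr.
by apply: ED => //; apply/E_le/slexx.
Qed.

Lemma preorder_congruence_prime : prime_congruence preorder_congruence.
Proof.
have [_ _ _ Ecanc] := E_pre.
have E0 f : quot_pi preorder_congruence f <> 0 -> ~ q f.
  move=> nf0 qf; apply: nf0; apply/quot_piP; split; first exact: E_q.
  exact/E_le/sle0.
split=> [allE|f g|f].
- by apply: E_x; have [] := allE x 1.
- rewrite -(quot_piK f) -(quot_piK g) !preorder_congruence_sle.
  exact: maximal_preorder_total.
- move=> nf0; split=> // g h.
  move: nf0; rewrite -(quot_piK f) -(quot_piK g) -(quot_piK h) => /E0 nqf.
  rewrite -!rmorphM => /quot_piP[h1 h2]; apply/quot_piP.
  by split; apply: (Ecanc _ _ _ nqf).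
Qed.

End MaximalPreorder.

Lemma valuation_subsemiringP (P : congruence R) y :
  valuation_subsemiring P y <-> sle (quot_pi P y) 1.
Proof.
rewrite /valuation_subsemiring /= /residue_abs /sle.
rewrite -(rmorph1 (loc_in (@cancellative_elt (quotient P)))) -rmorphD /=.
split=> [/frac_cancelP|->] //; rewrite !mulr1; exact.
Qed.

Section Existence.
Variables (A : set R) (x : R).
Hypothesis A_sub : subsemiring A.

(** The elements of this ideal vanish at every prime congruence at which [A]
    is bounded by [1] and [x] is not: there [x n <= a n <= n] and [x > 1] force
    [n = 0]. *)
Definition integrality_ideal :=
  [set f | exists n a, [/\ A a, sle f n & sle (x * n) (a * n)]].

Lemma integrality_ideal_ideal : ideal integrality_ideal.
Proof.
have [A0 A1 AD AM] := A_sub; split.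
- by exists 0, 0; split; rewrite ?mulr0 //; apply: slexx.
- move=> f g [n [a [Aa fn xn]]] [k [b [Ab gk xk]]]; exists (n + k), (a + b).
  split; [exact: AD|exact: sle_add|].
  rewrite !mulrDr; apply: sle_lub.
    apply: sle_trans xn _; apply: sle_trans (sle_addl _ _).
    by apply: sle_mul2r; apply: sle_addl.
  apply: sle_trans xk _; apply: sle_trans (sle_addr _ _).
  by apply: sle_mul2r; apply: sle_addr.
- move=> c f [n [a [Aa fn xn]]]; exists (c * n), a; split=> //.
    exact: sle_mul2l.
  by rewrite !(mulrCA _ c); apply: sle_mul2l.
Qed.

(** If [n >= z * i] witnesses that [z * i] lies in the ideal, then
    [n + z * w] witnesses it for [z * w], since
    [x (z w) <= z (w a + i) <= a (z w) + n]. *)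
Lemma integrality_ideal_step z w i a : A a -> sle (w * x) (w * a + i) ->
  integrality_ideal (z * i) -> integrality_ideal (z * w).
Proof.
have [A0 A1 AD AM] := A_sub.
move=> Aa wx [n [b [Ab zn xn]]]; exists (n + z * w), (a + b + 1).
split; [by apply: (AD); first apply: (AD)|exact: sle_addr|].
have -> : (a + b + 1) * (n + z * w) =
  b * n + (z * w * a + n) + (a * n + b * (z * w) + z * w) by ring.
rewrite mulrDr; apply: sle_trans (sle_addl _ _); apply: sle_add xn _.
have -> : x * (z * w) = z * (w * x) by ring.
apply: sle_trans (sle_mul2l z wx) _.
by rewrite mulrDr mulrA; apply: sle_add => //; apply: slexx.
Qed.

(** The kernel of the congruence is a minimal prime [q] over the integrality
    ideal. *)
Lemma exists_prime_congruence : ~ integrality_ideal 1 ->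
  exists P, [/\ prime_congruence P, A `<=` valuation_subsemiring P
    & ~ valuation_subsemiring P x].
Proof.
have [A0 A1 AD AM] := A_sub; move=> J1.
have [||f ->//|q [q_prime Jq _ q_J q_min]] :=
    @minimal_prime R integrality_ideal [set 1] integrality_ideal_ideal.
- by [].
- by move=> f g -> ->; rewrite /= mul1r.
have [[q0 qD qM] q1 qP] := q_prime.
have qX w m : ~ q w -> ~ q (w ^+ m).
  by move=> qw; elim: m => [|m IH]; [rewrite expr0|rewrite exprS => /qP[]].
have q_down f g : sle f g -> q g -> q f.
  move=> fg /q_J[w [m [qw [n [a [Aa wn xn]]]]]].
  have /Jq/qP[//|] : integrality_ideal (w * f ^+ m).
    exists n, a; split=> //; apply: sle_trans wn.
    by apply: sle_mul2l; apply: sle_exp.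
  by apply: contraPP; apply: qX.
(* The order of [R] with [A <= 1], [q <= 0], and elements outside [q] made
   cancellable. *)
pose E0 := [set hk : R * R | exists w i a,
  [/\ ~ q w, q i, A a & sle (w * hk.1) (a * w * hk.2 + i)]].
have E0_pre : compatible_preorder q E0.
  split=> /=.
  - move=> f g h [w [i [a [qw qi Aa fg]]]] [w' [i' [a' [qw' qi' Aa' gh]]]].
    exists (w' * w), (w' * i + a * w * i'), (a * a'); split.
    + by move=> /qP[].
    + by apply: (qD); apply: qM.
    + exact: AM.
    + rewrite -mulrA; apply: sle_trans (sle_mul2l w' fg) _.
      have -> : w' * (a * w * g + i) = a * w * (w' * g) + w' * i by ring.
      rewrite (addrC (w' * i)) addrA; apply: sle_add; last exact: slexx.
      apply: sle_trans (sle_mul2l _ gh) _; rewrite mulrDr.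
      apply: sle_add; last exact: slexx.
      by rewrite /sle; have -> : a * w * (a' * w' * h) = a * a' * (w' * w) * h
        by ring.
  - move=> f g h [w [i [a [qw qi Aa fh]]]] [w' [i' [a' [qw' qi' Aa' gh]]]].
    exists (w * w'), (w' * i + w * i'), (a + a'); split.
    + by move=> /qP[].
    + by apply: (qD); apply: qM.
    + exact: AD.
    + rewrite mulrDr.
      apply: (@sle_trans (w' * (a * w * h + i) + w * (a' * w' * h + i'))).
        apply: sle_add; first by rewrite mulrAC mulrC; apply: sle_mul2l.
        by rewrite -mulrA; apply: sle_mul2l.
      rewrite /sle; have -> : w' * (a * w * h + i) + w * (a' * w' * h + i') =
        (a + a') * (w * w') * h + (w' * i + w * i') by ring.
      exact: idem.
  - move=> f g h [w [i [a [qw qi Aa fg]]]]; exists w, (h * i), a.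
    split=> //; first exact: qM.
    have -> : a * w * (h * g) + h * i = h * (a * w * g + i) by ring.
    by rewrite mulrCA; apply: sle_mul2l.
  - move=> f g w qw [w' [i [a [qw' qi Aa fg]]]]; exists (w' * w), i, a.
    split=> //; first by move=> /qP[].
    move: fg; rewrite /= -mulrA; congr (sle _ _); ring.
have E0_le f g : sle f g -> E0 (f, g).
  by move=> fg; exists 1, 0, 1; split; rewrite //= !mul1r addr0.
have E0_q f : q f -> E0 (f, 0).
  move=> qf; exists 1, f, 1; split; rewrite //= mul1r mulr0 add0r; exact: slexx.
have E0_x : ~ E0 (x, 1).
  move=> [w [i [a [qw qi Aa]]]]; rewrite /= mulr1 (mulrC a) => wx.
  (* Some [v i^m] with [v] outside [q] lies in the integrality ideal; trading
     the factors [i] for [w] one at a time puts [v w^m] there, although it is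
     outside [q]. *)
  have [v [m [qv]]] := q_J i qi.
  elim: m v qv => [|m IH] v qv; first by rewrite mulr1 => /Jq.
  rewrite exprSr mulrA => /(integrality_ideal_step Aa wx) h.
  by apply: (IH (v * w)); [move=> /qP[]|rewrite mulrAC].
have [|F [X1 FX1] FQ Ftot|E [E0E [E_pre E_x]] E_max] :=
    @zorn_above _ (fun E => compatible_preorder q E /\ ~ E (x, 1)) E0.
- by [].
- have FU X Y : F X -> F Y -> exists Z, [/\ F Z, X `<=` Z & Y `<=` Z].
    by move=> FX FY; have [h|h] := Ftot X Y FX FY; [exists Y|exists X]; split.
  split; last by move=> [X /FQ[_ [_ Xx]]].
  split=> /=.
  + move=> f g h [X FX Xfg] [Y FY Ygh]; have [Z [FZ XZ YZ]] := FU X Y FX FY.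
    have [_ [[Ztr _ _ _] _]] := FQ Z FZ.
    by exists Z => //; apply: Ztr (XZ _ Xfg) (YZ _ Ygh).
  + move=> f g h [X FX Xfg] [Y FY Ygh]; have [Z [FZ XZ YZ]] := FU X Y FX FY.
    have [_ [[_ ZD _ _] _]] := FQ Z FZ.
    by exists Z => //; apply: ZD (XZ _ Xfg) (YZ _ Ygh).
  + move=> f g h [X FX Xfg]; have [_ [[_ _ XM _] _]] := FQ X FX.
    by exists X => //; apply: XM.
  + move=> f g w qw [X FX Xfg]; have [_ [[_ _ _ Xc] _]] := FQ X FX.
    by exists X => //; apply: Xc Xfg.
have E_le f g : sle f g -> E (f, g) by move=> /E0_le/E0E.
have E_q f : q f -> E (f, 0) by move=> /E0_q/E0E.
have E_max' E' : E `<=` E' -> compatible_preorder q E' -> ~ E' (x, 1) -> E' = E.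
  by move=> EE' E'p E'x; apply: E_max.
exists (preorder_congruence E_pre E_le); split.
- exact: (@preorder_congruence_prime E q x).
- move=> a Aa; apply/valuation_subsemiringP.
  rewrite -(rmorph1 (quot_pi _)); apply/preorder_congruence_sle/E0E.
  by exists 1, 0, a; split; rewrite //= !mulr1 mul1r addr0; apply: slexx.
- move=> /valuation_subsemiringP.
  by rewrite -(rmorph1 (quot_pi _)) => /preorder_congruence_sle.
Qed.

End Existence.

Lemma valuative_sub_quasi_integral A : subsemiring A ->
  valuative_closure A `<=` quasi_integral_closure A.
Proof.
move=> A_sub x Vx; apply: contrapT => nQx.
have [|P [P_prime AP []]] := @exists_prime_congruence A x A_sub; last exact: Vx.
by move=> [n [a [Aa n1 xn]]]; apply: nQx; apply: bounded_quasi_integral xn.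
Qed.

End Idempotent.

(** * Strict inequalities in totally ordered cancellative semirings

    The strict inequality [z < y] is expressed as [~ sle y z]. *)

Section TotallyOrderedCancellative.
Variable Q : comPzSemiRingType.
Hypotheses (Q_total : totally_ordered Q) (Q_canc : cancellative Q)
  (Q1 : 1 <> 0 :> Q).
Implicit Types (y z : Q).

Lemma total_idem y : y + y = y.
Proof. by have [h|h] := Q_total y y. Qed.

Lemma nsle_sle y z : ~ sle y z -> sle z y.
Proof. by have [h|h] := Q_total y z. Qed.

Lemma nsle_add y z z' : ~ sle y z -> ~ sle y z' -> ~ sle y (z + z').
Proof.
have [e|e] := Q_total z z'; first by rewrite [_ + _]e.
by rewrite addrC [_ + _]e.
Qed.

Lemma nsle_neq0 y z : ~ sle y z -> y <> 0.
Proof. by move=> + y0; apply; rewrite y0; apply: sle0. Qed.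

Lemma sle_cancel y z z' : y <> 0 -> sle (y * z) (y * z') -> sle z z'.
Proof. by move=> /Q_canc[_ yI]; rewrite /sle -mulrDr => /yI. Qed.

Lemma nsle_mul y z y' z' : y' <> 0 -> ~ sle y z -> sle z' y' ->
  ~ sle (y' * y) (z' * z).
Proof.
move=> y'0 yz zy' h; apply: yz; apply: (sle_cancel y'0).
by apply: sle_trans h _; apply: sle_mul2r.
Qed.

Lemma mulQ_neq0 y z : y <> 0 -> z <> 0 -> y * z <> 0.
Proof. by move=> /Q_canc[_ yI] z0; rewrite -(mulr0 y) => /yI. Qed.

Lemma prodQ_neq0 (J : Type) (s : seq J) (F : J -> Q) :
  (forall i, F i <> 0) -> \prod_(i <- s) F i <> 0.
Proof.
move=> F0; elim: s => [|i s IH]; first by rewrite big_nil.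
by rewrite big_cons; apply: mulQ_neq0.
Qed.

Lemma sle_prod (J : finType) (P : pred J) (F G : J -> Q) :
  (forall i, P i -> sle (F i) (G i)) ->
  sle (\prod_(i | P i) F i) (\prod_(i | P i) G i).
Proof.
move=> FG; elim/big_rec2: _ => [|i a b Pi ab]; first exact/slexx/total_idem.
by apply: sle_mul => //; apply: FG.
Qed.

End TotallyOrderedCancellative.

(** * Monoid algebras and tropicalization *)

Section MonalgRing.
Variables (K : comPzRingType) (M : nmodType).
Implicit Types (F G : monalg K M) (u w : M) (c : K).

Definition mopp F : monalg K M := monom 0 (-1) * F.

Fact maddN : left_inverse 0 mopp +%R.
Proof.
move=> F; have <- : (monom 0 (-1 + 1)) * F = mopp F + F.
  by rewrite monomD mulrDl -[monom 0 1]/(1 : monalg K M) mul1r.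
by rewrite addNr monom0 mul0r.
Qed.

HB.instance Definition _ := GRing.Nmodule_isZmodule.Build (monalg K M) maddN.

End MonalgRing.

Section MonalgCoef.
Variables (S : comPzSemiRingType) (M : nmodType).
Implicit Types (f g h : monalg S M) (u w z : M) (c : S).

Lemma monomM u w c d : monom u c * monom w d = monom (u + w) (c * d) :> monalg S M.
Proof. exact: mmul_monom. Qed.

Lemma sum_fset_if (r : {fset M}) (G : M -> S) u :
  \sum_(z <- r) (if u == z then G z else 0) = if u \in r then G u else 0.
Proof.
case: ifPn => ur.
  rewrite (big_fsetD1 u ur) /= eqxx big1_seq ?addr0 // => z /=.
  by rewrite in_fsetD1 eq_sym => /andP[/negPf->].
by rewrite big1_seq // => z /= zr; case: eqP ur => // ->; rewrite zr.
Qed.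

Lemma mcoef_monomM u w c f : injective (+%R w : M -> M) ->
  mcoef (monom w c * f) (w + u) = c * mcoef f u.
Proof.
move=> wI; rewrite [in LHS](monalg_sum f) mulr_sumr mcoef_sum.
under eq_bigr do rewrite monomM mcoef_monom (inj_eq wI).
by rewrite sum_fset_if; case: ifPn => // /mcoef_eq0->; rewrite mulr0.
Qed.

Lemma mcoef_scale c f u : mcoef (monom 0 c * f) u = c * mcoef f u.
Proof.
by rewrite -{1}[u]add0r mcoef_monomM // => z t; rewrite !add0r.
Qed.

Lemma mcoefM f g z :
  mcoef (f * g) z = \sum_(u <- msupp f) \sum_(w <- msupp g)
    (if z == u + w then mcoef f u * mcoef g w else 0).
Proof.
rewrite [LHS]mcoef_sum; apply: eq_bigr => u _.
by rewrite mcoef_sum; apply: eq_bigr => w _; rewrite mcoef_monom.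
Qed.

Lemma mcoef_mdelete f i u :
  mcoef (mdelete f i) u = if u == i then 0 else mcoef f u.
Proof.
rewrite /mdelete mcoef_sum big_mkcond /=.
rewrite (eq_bigr (fun z =>
    if u == z then (if z == i then 0 else mcoef f z) else 0)).
  rewrite sum_fset_if; case: ifPn => // /mcoef_eq0->; by rewrite if_same.
by move=> z _; rewrite mcoef_monom; case: (z == i); rewrite ?if_same.
Qed.

Lemma sle_mcoefP f g : sle f g <-> forall u, sle (mcoef f u) (mcoef g u).
Proof.
split=> [fg u|fg]; first by rewrite /sle -mcoefD fg.
by apply: monalgP => u; rewrite mcoefD; apply: fg.
Qed.

Hypothesis idem : forall c, c + c = c.

Lemma monalg_idem f : f + f = f.
Proof. by apply: monalgP => u; rewrite mcoefD. Qed.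

Lemma sle_monom u c d : sle c d -> sle (monom u c : monalg S M) (monom u d).
Proof. by rewrite /sle -monomD => ->. Qed.

Lemma sle_term f u : sle (monom u (mcoef f u)) f.
Proof.
apply/sle_mcoefP => w; rewrite mcoef_monom.
by case: eqP => [->|_]; [apply: slexx|apply: sle0].
Qed.

Lemma sle_mcoefM f g u w : sle (mcoef f u * mcoef g w) (mcoef (f * g) (u + w)).
Proof.
have /sle_mcoefP/(_ (u + w)) :
    sle (monom u (mcoef f u) * monom w (mcoef g w)) (f * g).
  by apply: sle_mul; apply: sle_term.
by rewrite monomM mcoef_monom eqxx.
Qed.

Hypothesis S_total : totally_ordered S.

(** In a totally ordered semiring a sum is its largest term. *)
Lemma sum_attained (I : eqType) (r : seq I) (F : I -> S) :
  \sum_(i <- r) F i <> 0 ->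
  exists2 i, i \in r & \sum_(i <- r) F i = F i.
Proof.
elim: r => [|i r IH]; first by rewrite big_nil.
rewrite big_cons; have [h|h] := S_total (F i) (\sum_(i <- r) F i).
  by rewrite [_ + _]h => /IH[k kr ->]; exists k; rewrite // inE kr orbT.
by rewrite addrC [_ + _]h => _; exists i; rewrite // inE eqxx.
Qed.

Lemma mcoefM_attained f g z : mcoef (f * g) z <> 0 ->
  exists u w, [/\ u \in msupp f, w \in msupp g, z = u + w
    & mcoef (f * g) z = mcoef f u * mcoef g w].
Proof.
rewrite mcoefM => nz; have [u uf uE] := sum_attained nz.
rewrite uE in nz *; have [w wg wE] := sum_attained nz.
by rewrite wE in nz *; exists u, w; split=> //; case: eqP nz.
Qed.

End MonalgCoef.

Section TropMap.
Variables (K : fieldType) (S : comPzSemiRingType) (M : nmodType) (v : K -> S).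
Hypotheses (idem : forall c : S, c + c = c) (v_val : valuation v).
Hypothesis S_total : totally_ordered S.
Implicit Types (F G : monalg K M) (u : M) (a b : K).

Lemma mcoef_trop F u : mcoef (trop v F) u = v (mcoef F u).
Proof.
have [v0 _ _ _] := v_val.
rewrite /trop mcoef_sum; under eq_bigr do rewrite mcoef_monom.
by rewrite sum_fset_if; case: ifPn => // /mcoef_eq0->; apply/esym/v0.
Qed.

(** [1] is the only square root of [1] in a totally ordered semiring. *)
Lemma valuationN1 : v (-1) = 1.
Proof.
have [_ vM v1 _] := v_val.
have vv : v (-1) * v (-1) = 1 by rewrite -vM mulrNN mulr1.
by have [h|h] := S_total (v (-1)) 1; have := sle_mul2l (v (-1)) h;
  rewrite vv mulr1 => h'; apply: sle_anti.
Qed.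

Lemma valuationN a : v (- a) = v a.
Proof. by have [_ vM _ _] := v_val; rewrite -mulN1r vM valuationN1 mul1r. Qed.

Lemma trop0 : trop v (0 : monalg K M) = 0.
Proof.
have [v0 _ _ _] := v_val.
by apply: monalgP => u; rewrite mcoef_trop !mcoef0; apply/v0.
Qed.

Lemma trop_monom u a : trop v (monom u a) = monom u (v a).
Proof.
have [v0 _ _ _] := v_val.
apply: monalgP => w; rewrite mcoef_trop !mcoef_monom.
by case: ifP => // _; apply/v0.
Qed.

Lemma mcoefN F u : mcoef (- F) u = - mcoef F u.
Proof. by apply/eqP; rewrite -addr_eq0 -mcoefD addNr mcoef0. Qed.

Lemma tropN F : trop v (- F) = trop v F.
Proof.
by apply: monalgP => u; rewrite !mcoef_trop mcoefN valuationN.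
Qed.

Lemma trop_add F G : sle (trop v (F + G)) (trop v F + trop v G).
Proof.
have [_ _ _ vD] := v_val; apply/sle_mcoefP => u.
by rewrite mcoefD !mcoef_trop mcoefD.
Qed.

Lemma trop_sum (I : Type) (r : seq I) (F : I -> monalg K M) :
  sle (trop v (\sum_(i <- r) F i)) (\sum_(i <- r) trop v (F i)).
Proof.
elim: r => [|i r IH]; first by rewrite !big_nil trop0; apply: sle0.
rewrite !big_cons; apply: sle_trans (trop_add _ _) _.
by apply: sle_add => //; [exact: monalg_idem|apply: slexx; exact: monalg_idem].
Qed.

Lemma trop_monomM u a F : sle (trop v (monom u a * F)) (monom u (v a) * trop v F).
Proof.
have [_ vM _ _] := v_val.
rewrite [in X in sle X _](monalg_sum F) mulr_sumr.
apply: sle_trans (trop_sum _ _) _.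
rewrite [in X in sle _ X]/trop mulr_sumr.
under eq_bigr do rewrite monomM trop_monom vM.
under [X in sle _ X]eq_bigr do rewrite monomM.
by apply: slexx; exact: monalg_idem.
Qed.

Lemma trop_mul F G : sle (trop v (F * G)) (trop v F * trop v G).
Proof.
have idemM := @monalg_idem S M idem.
rewrite [in X in sle X _](monalg_sum F) mulr_suml.
apply: sle_trans (trop_sum _ _) _.
apply: sle_sum => // u uF; apply: sle_trans (trop_monomM _ _ _) _.
by apply/sle_mul2r; rewrite -mcoef_trop; apply: sle_term.
Qed.

End TropMap.

(** * Inequalities in the bend quotient *)

Section Bounds.
Variables (K : fieldType) (S : comPzSemiRingType) (M : nmodType) (v : K -> S).
Hypotheses (idem : forall c : S, c + c = c) (v_val : valuation v).
Hypothesis S_total : totally_ordered S.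
Hypothesis addI : forall z, injective (+%R z : M -> M).
Variable I : set (monalg K M).
Hypothesis I_ideal : ideal I.
Implicit Types (f g h : monalg S M) (F G : monalg K M) (u : M) (c : S).

Let idemM : forall f, f + f = f := @monalg_idem S M idem.

(** A reason for [c chi^u <= g] in the bend quotient: if [chi^u = G] modulo
    [I], the bend relation of [trop (chi^u - G)] at [u] gives
    [chi^u <= trop G]. *)
Definition bounded g u c :=
  exists2 G, I (monom u 1 - G) & sle (monom 0 c * trop v G) g.

Definition dominated f g := forall u, bounded g u (mcoef f u).

Lemma bounded_le g g' u c : sle g g' -> bounded g u c -> bounded g' u c.
Proof. by move=> gg' [G IG h]; exists G => //; apply: sle_trans gg'. Qed.

Lemma bounded_mcoef g u : bounded g u (mcoef g u).
Proof.
have [I0 _ _] := I_ideal; have [_ _ v1 _] := v_val.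
exists (monom u 1); first by rewrite subrr.
by rewrite trop_monom // v1 monomM add0r mulr1; apply: sle_term.
Qed.

Lemma dominated_le f g : sle f g -> dominated f g.
Proof.
move=> /sle_mcoefP fg u; have [G IG h] := bounded_mcoef g u; exists G => //.
by apply: sle_trans h; apply/sle_mul2r/sle_monom.
Qed.

(** If [chi^u = G] and [chi^z = H_z] modulo [I] for the monomials [chi^z] of
    [G], then [chi^u = \sum_z G_z H_z] modulo [I], with coefficients bounded
    by the products of the two bounds. *)
Lemma dominated_trans f g h : dominated f g -> dominated g h -> dominated f h.
Proof.
have [I0 ID IM] := I_ideal; have [_ vM v1 _] := v_val.
move=> fg gh u; have [G IG fG] := fg u.
have /choice[H HP] : forall z, exists H : monalg K M,
    I (monom z 1 - H) /\ sle (monom 0 (mcoef g z) * trop v H) h.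
  by move=> z; have [H IH Hh] := gh z; exists H.
exists (\sum_(z <- msupp G) monom 0 (mcoef G z) * H z).
  have -> : monom u 1 - \sum_(z <- msupp G) monom 0 (mcoef G z) * H z =
      (monom u 1 - G) + \sum_(z <- msupp G) monom 0 (mcoef G z) * (monom z 1 - H z).
    under [in RHS]eq_bigr do rewrite mulrBr monomM add0r mulr1.
    by rewrite sumrB -monalg_sum addrA subrK.
  apply: (ID) => //; elim/big_rec: _ => // z F _ IF; apply: (ID) => //.
  by apply: IM; have [] := HP z.
apply: sle_trans (sle_mul2l _ (trop_sum idem v_val _ _)) _.
rewrite mulr_sumr; apply: sle_sum => // z zG.
apply: sle_trans (sle_mul2l _ (trop_monomM idem v_val _ _ _)) _.
have [_] := HP z; apply: sle_trans; rewrite mulrA; apply: sle_mul2r.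
rewrite monomM addr0; apply: sle_monom.
by move/sle_mcoefP/(_ z): fG; rewrite mcoef_scale mcoef_trop.
Qed.

Lemma dominated_add f g h : dominated f h -> dominated g h -> dominated (f + g) h.
Proof.
move=> fh gh u; rewrite mcoefD.
have [e|e] := S_total (mcoef f u) (mcoef g u); first by rewrite [_ + _]e.
by rewrite addrC [_ + _]e.
Qed.

Lemma dominated_mul f g h : dominated f g -> dominated (f * h) (g * h).
Proof.
have [I0 ID IM] := I_ideal; have [v0 vM v1 _] := v_val.
move=> fg z; have [->|/eqP nz] := eqVneq (mcoef (f * h) z) 0.
  exists (monom z 1); first by rewrite subrr.
  by rewrite monom0 mul0r; apply: sle0.
have [u [w [uf wh -> ->]]] := mcoefM_attained S_total nz.
have [G IG fG] := fg u; exists (monom w 1 * G).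
  by have := IM (monom w 1) _ IG; rewrite mulrBr monomM mulr1 addrC.
apply: sle_trans (sle_mul2l _ (trop_monomM idem v_val _ _ _)) _.
apply: (@sle_trans _ ((monom 0 (mcoef f u) * trop v G) * monom w (mcoef h w))).
  have -> : monom w (mcoef h w) = monom 0 (mcoef h w) * monom w 1 :> monalg S M.
    by rewrite monomM add0r mulr1.
  have -> : monom 0 (mcoef f u * mcoef h w) =
    monom 0 (mcoef f u) * monom 0 (mcoef h w) :> monalg S M.
    by rewrite monomM addr0.
  rewrite v1; set a := monom _ _; set b := monom _ _; set c := monom _ _.
  by rewrite /sle; have -> : a * trop v G * (b * c) = a * b * (c * trop v G) by ring.
by apply: sle_mul => //; apply: sle_term.
Qed.

(** Each coefficient of an element of the tropical ideal is a largest term of a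
    sum of multiples of tropicalizations, so one single multiple, lying below
    the element, already attains it. *)
Lemma trop_ideal_attained f u : trop_ideal v I f ->
  exists c F, [/\ I F, sle (monom 0 c * trop v F) f & c * v (mcoef F u) = mcoef f u].
Proof.
have [I0 ID IM] := I_ideal; have [v0 vM v1 _] := v_val.
have zeroP g w : mcoef g w = 0 -> exists c F,
    [/\ I F, sle (monom 0 c * trop v F) g & c * v (mcoef F w) = mcoef g w].
  by move=> ->; exists 0, 0; rewrite monom0 !mul0r; split=> //; apply: sle0.
move=> /(_ [set f | forall u, exists c F,
  [/\ I F, sle (monom 0 c * trop v F) f & c * v (mcoef F u) = mcoef f u]]).
move=> /(_ _ _ u); apply.
- split=> [w|g h gP hP w|a g gP w].
  + by apply: zeroP; rewrite mcoef0.
  + have [e|e] := S_total (mcoef g w) (mcoef h w).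
      have [c [F [IF Fh Fw]]] := hP w; exists c, F; split=> //.
        by apply: sle_trans Fh _; apply: sle_addr.
      by rewrite mcoefD [_ + _]e.
    have [c [F [IF Fg Fw]]] := gP w; exists c, F; split=> //.
      by apply: sle_trans Fg _; apply: sle_addl.
    by rewrite mcoefD addrC [_ + _]e.
  + have [/zeroP//|/eqP nz] := eqVneq (mcoef (a * g) w) 0.
    have [z [y [za yg -> ->]]] := mcoefM_attained S_total nz.
    have [c [F [IF Fg Fw]]] := gP y; exists (mcoef a z * c), (monom z 1 * F).
    split; [exact: IM| |by rewrite mcoef_monomM // mul1r -mulrA Fw].
    apply: sle_trans (sle_mul2l _ (trop_monomM idem v_val _ _ _)) _.
    apply: sle_trans (sle_mul (sle_term idem a z) Fg).
    rewrite v1 mulrA monomM add0r mulr1 mulrA monomM addr0.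
    exact: slexx.
- move=> _ [F IF <-] w; exists 1, F; split=> //.
    by rewrite [monom 0 1 * _]mul1r; apply: slexx.
  by rewrite mul1r mcoef_trop.
Qed.

(** If [F] in [I] has coefficient [F_i <> 0], then [chi^i] is congruent modulo
    [I] to minus the other terms of [F], divided by [F_i]. *)
Lemma dominated_bend f g : bend_relation (trop_ideal v I) f g ->
  dominated f g /\ dominated g f.
Proof.
have [I0 ID IM] := I_ideal; have [v0 vM v1 _] := v_val.
move=> [If [i i_f ->]]; split; last first.
  apply: dominated_le; apply/sle_mcoefP => u; rewrite mcoef_mdelete.
  by case: eqP => _; [apply: sle0|apply: slexx].
move=> u; have [->|ui] := eqVneq u i; last first.
  by have := bounded_mcoef (mdelete f i) u; rewrite mcoef_mdelete (negPf ui).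
have [c [F [IF Ff Fi]]] := trop_ideal_attained i If.
have nFi : mcoef F i != 0.
  apply: contraTneq i_f => Fi0; rewrite mem_msupp negbK -Fi Fi0.
  by rewrite (v0 0).2 // mulr0.
exists (monom i 1 - monom 0 (mcoef F i)^-1 * F).
  by rewrite opprB addrC subrK; apply: IM.
apply/sle_mcoefP => z; rewrite mcoef_scale mcoef_trop // mcoefD mcoefN.
rewrite mcoef_monom mcoef_scale mcoef_mdelete.
case: eqP => [->|_]; first by rewrite mulVf // subrr (v0 0).2 // mulr0; apply: sle0.
rewrite sub0r valuationN // vM -Fi -!mulrA (mulrA (v (mcoef F i))) -vM mulfV //.
by rewrite v1 mul1r; move/sle_mcoefP/(_ z): Ff; rewrite mcoef_scale mcoef_trop.
Qed.

Let equidominated f g := dominated f g /\ dominated g f.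

Fact equidominated_refl f : equidominated f f.
Proof. by split; apply/dominated_le/slexx. Qed.

Fact equidominated_sym f g : equidominated f g -> equidominated g f.
Proof. by case. Qed.

Fact equidominated_trans f g h :
  equidominated f g -> equidominated g h -> equidominated f h.
Proof.
by move=> [fg gf] [gh hg]; split; [apply: dominated_trans fg gh
  |apply: dominated_trans hg gf].
Qed.

Fact equidominated_add f f' g g' :
  equidominated f f' -> equidominated g g' -> equidominated (f + g) (f' + g').
Proof.
have le_r (h k k' : monalg S M) : dominated h k -> dominated h (k + k').
  by move=> hk u; apply: bounded_le (hk u); apply: sle_addl.
have le_l (h k k' : monalg S M) : dominated h k -> dominated h (k' + k).
  by move=> hk u; apply: bounded_le (hk u); apply: sle_addr.
by move=> [ff' f'f] [gg' g'g]; split; apply: dominated_add;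
  [apply: le_r|apply: le_l|apply: le_r|apply: le_l].
Qed.

Fact equidominated_mul f f' g g' :
  equidominated f f' -> equidominated g g' -> equidominated (f * g) (f' * g').
Proof.
move=> [ff' f'f] [gg' g'g]; split.
  apply: dominated_trans (dominated_mul g ff') _.
  by rewrite ![f' * _]mulrC; apply: dominated_mul.
apply: dominated_trans (dominated_mul g' f'f) _.
by rewrite ![f * _]mulrC; apply: dominated_mul.
Qed.

(** Domination in both directions is a congruence that contains the bend
    relations, hence the bend congruence. *)
Lemma bend_dominated f g : Bend (trop_ideal v I) f g -> dominated f g.
Proof.
move=> /(_ (Congruence equidominated_refl equidominated_sym equidominated_trans
  equidominated_add equidominated_mul)) [] //.
exact: dominated_bend.
Qed.

End Bounds.

(** * Cancelling a nonzero factor at a prime congruence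

    [phi] stands for the reduction of [S[M]] modulo a prime congruence of the
    bend quotient or of one of its localizations. *)

Section PrimeReduction.
Variables (K : fieldType) (S : comPzSemiRingType) (M : nmodType) (v : K -> S).
Hypotheses (idem : forall c : S, c + c = c) (v_val : valuation v).
Hypotheses (S_total : totally_ordered S) (S_field : semifield S).
Hypothesis addI : forall z, injective (+%R z : M -> M).
Variable I : set (monalg K M).
Hypothesis I_ideal : ideal I.
Variables (Q : comPzSemiRingType) (phi : {rmorphism monalg S M -> Q}).
Hypotheses (Q_total : totally_ordered Q) (Q_canc : cancellative Q)
  (Q1 : 1 <> 0 :> Q).
Hypothesis phi_bend : forall f g, Bend (trop_ideal v I) f g -> phi f = phi g.
Implicit Types (f g h : monalg S M) (F G : monalg K M) (u w : M) (c : S) (y z : Q).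

Lemma phi_le f g : sle f g -> sle (phi f) (phi g).
Proof. by rewrite /sle -rmorphD => ->. Qed.

(** The Gauss seminorm: the largest value of a term of [F] at the prime
    congruence. *)
Definition gauss F := phi (trop v F).

Lemma gauss_add F G : sle (gauss (F + G)) (gauss F + gauss G).
Proof. by rewrite /gauss -rmorphD; apply/phi_le/trop_add. Qed.

Lemma gauss_mul F G : sle (gauss (F * G)) (gauss F * gauss G).
Proof. by rewrite /gauss -rmorphM; apply/phi_le/trop_mul. Qed.

Lemma gaussN F : gauss (- F) = gauss F.
Proof. by rewrite /gauss tropN. Qed.

Lemma gauss_prod (J : Type) (r : seq J) (F : J -> monalg K M) :
  sle (gauss (\prod_(i <- r) F i)) (\prod_(i <- r) gauss (F i)).
Proof.
have [_ _ v1 _] := v_val.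
elim: r => [|i r IH].
  rewrite !big_nil /gauss trop_monom // v1 rmorph1; exact/slexx/total_idem.
rewrite !big_cons; apply: sle_trans (gauss_mul _ _) _; exact: sle_mul2l.
Qed.

Definition chi u := phi (monom u 1).

Lemma gauss_chi u : gauss (monom u 1) = chi u.
Proof. by have [_ _ v1 _] := v_val; rewrite /gauss trop_monom // v1. Qed.

Lemma chiD u w : chi (u + w) = chi u * chi w.
Proof. by rewrite /chi -rmorphM monomM mulr1. Qed.

Definition dominant_term u F := ~ sle (chi u) (gauss (F - monom u 1)).

Lemma dominant_term1 : dominant_term 0 1.
Proof.
rewrite /dominant_term subrr /gauss trop0 // rmorph0 /chi rmorph1.
by rewrite /sle addr0.
Qed.

Lemma dominant_termD u F G : dominant_term u F -> ~ sle (chi u) (gauss G) ->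
  dominant_term u (F + G).
Proof.
move=> uF uG h; apply: (nsle_add Q_total uF uG); apply: sle_trans h _.
by rewrite addrAC; apply: gauss_add.
Qed.

Lemma dominant_termM u w F G : dominant_term u F -> dominant_term w G ->
  dominant_term (u + w) (F * G).
Proof.
move=> uF wG; rewrite /dominant_term.
set F' := F - monom u 1 in uF *; set G' := G - monom w 1 in wG *.
have -> : F * G - monom (u + w) 1 =
    monom w 1 * F' + (F' * G' + monom u 1 * G').
  have -> : monom (u + w) 1 = monom u 1 * monom w 1 :> monalg K M.
    by rewrite monomM mulr1.
  by rewrite /F' /G'; ring.
move=> h; have {h} := sle_trans (sle_trans h (gauss_add _ _))
  (sle_add (total_idem Q_total) (gauss_mul _ _) (sle_trans (gauss_add _ _)
  (sle_add (total_idem Q_total) (gauss_mul _ _) (gauss_mul _ _)))).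
rewrite !gauss_chi chiD; apply: (nsle_add Q_total); last apply: (nsle_add Q_total).
- rewrite mulrC; apply: (nsle_mul Q_canc) => //; first exact: nsle_neq0 wG.
  exact/slexx/total_idem.
- apply: (nsle_mul Q_canc); [exact: nsle_neq0 uF|exact: wG|].
  exact: (nsle_sle Q_total).
- apply: (nsle_mul Q_canc); [exact: nsle_neq0 uF|exact: wG|].
  exact/slexx/total_idem.
Qed.

(** For [F] in [I] the bend relation at [u] says that the term of exponent [u]
    is bounded by the other ones, which are all terms of [F - chi^u]. *)
Lemma dominant_term_notin u F : dominant_term u F -> ~ I F.
Proof.
have [v0 vM v1 vD] := v_val.
move=> uF IF; pose a := mcoef F u - 1.
(* The coefficient of [F] at [u] is [1] up to a strictly smaller error, so it
   has value at least [1]. *)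
have a1 : ~ sle 1 (phi (monom 0 (v a))).
  move=> h; apply: uF; apply: (@sle_trans _ (chi u * phi (monom 0 (v a)))).
    by rewrite -[X in sle X _]mulr1; apply: sle_mul2l.
  rewrite -rmorphM monomM addr0 mul1r; apply: phi_le.
  have -> : a = mcoef (F - monom u 1) u.
    by rewrite mcoefD mcoefN mcoef_monom eqxx.
  by rewrite -mcoef_trop //; apply: sle_term.
have F1 : sle 1 (phi (monom 0 (v (mcoef F u)))).
  apply: contrapT => h; apply: (nsle_add Q_total h a1).
  rewrite -rmorphD -monomD -(rmorph1 phi); apply/phi_le/sle_monom.
  have := vD (mcoef F u) (- a); rewrite opprB addrC subrK v1.
  by rewrite -opprB valuationN.
have uF' : u \in msupp (trop v F).
  rewrite mem_msupp mcoef_trop //; apply/eqP => F0; apply: Q1.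
  by apply: sle0_eq0; move: F1; rewrite F0 monom0 rmorph0.
apply: uF; apply: (@sle_trans _ (phi (trop v F))).
  apply: (@sle_trans _ (chi u * phi (monom 0 (v (mcoef F u))))).
    by rewrite -[X in sle X _]mulr1; apply: sle_mul2l.
  rewrite -rmorphM monomM addr0 mul1r; apply: phi_le.
  by rewrite -mcoef_trop //; apply: sle_term.
have -> : phi (trop v F) = phi (mdelete (trop v F) u).
  apply: phi_bend => C; apply; split; last by exists u.
  by move=> J _; apply; exists F.
apply/phi_le/sle_mcoefP => w; rewrite mcoef_mdelete.
case: eqP => [_|/eqP wu]; first exact: sle0.
rewrite !mcoef_trop // mcoefD mcoefN mcoef_monom (negPf wu) oppr0 addr0.
exact: slexx.
Qed.

Lemma dominant_term_prod u (J : Type) (r : seq J) (F : J -> monalg K M) :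
  (forall i, dominant_term u (F i)) ->
  exists w, dominant_term w (\prod_(i <- r) F i) /\ chi w = chi u ^+ size r.
Proof.
move=> uF; elim: r => [|i r [w [IH e]]].
  by exists 0; rewrite big_nil /chi rmorph1; split=> //; apply: dominant_term1.
exists (u + w); rewrite big_cons chiD e exprS; split=> //.
exact: dominant_termM.
Qed.

(** The entries of [A] are small only up to the ratios [lam j / lam i], as in a
    matrix conjugated by a diagonal one; these ratios disappear from each term
    of the Leibniz expansion. *)
Section Determinant.
Variables (k : nat) (A : 'M[monalg K M]_k) (u : M) (sig r : Q) (lam : 'I_k -> Q).
Hypotheses (lam0 : forall i, lam i <> 0)
  (rt : ~ sle (sig * chi u) r).
Hypothesis A_le : forall i j, sle (sig * lam i * gauss (A i j)) (lam j * r).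

(** A permutation other than the identity picks at least one entry off the
    diagonal, which is strictly smaller than [chi u]. *)
Lemma det_offdiag (sigma : 'S_k) : sigma != 1%g ->
  ~ sle (chi u ^+ k)
      (\prod_i gauss (((monom u 1)%:M - A) i (sigma i))).
Proof.
move=> sigma1.
pose B := (monom u 1)%:M - A.
pose y i := if sigma i == i then sig * chi u else r.
have By i : sle (sig * lam i * gauss (B i (sigma i))) (lam (sigma i) * y i).
  rewrite /B /y !mxE eq_sym; case: eqP => [e|_]; last first.
    by rewrite mulr0n add0r gaussN.
  rewrite mulr1n; apply: sle_trans (sle_mul2l _ (gauss_add _ _)) _.
  rewrite gaussN gauss_chi mulrDr; apply: sle_lub.
    rewrite e mulrAC [X in sle X _]mulrC; exact/slexx/total_idem.
  by apply: sle_trans (A_le _ _) _; apply/sle_mul2l/(nsle_sle Q_total).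
have lt_y : ~ sle ((sig * chi u) ^+ k) (\prod_i y i).
  have [i0 i0P] : exists i0, sigma i0 != i0.
    apply/existsP; apply: contraR sigma1 => /existsPn h.
    by apply/eqP/permP => i; rewrite perm1; apply/eqP; rewrite -[_ == _]negbK h.
  have -> : (sig * chi u) ^+ k = \prod_(i < k) (sig * chi u).
    by rewrite prodr_const card_ord.
  rewrite (bigD1 i0) //= [X in sle _ X](bigD1 i0) //= {1}/y (negPf i0P).
  rewrite ![sig * chi u * _]mulrC ![r * _]mulrC; apply: (nsle_mul Q_canc) => //.
    rewrite big_mkcond; apply: (prodQ_neq0 Q_canc Q1) => i.
    by case: ifP => // _; exact: nsle_neq0 rt.
  apply: (sle_prod Q_total) => i _; rewrite /y; case: ifP => _; last first.
    exact: (nsle_sle Q_total).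
  exact/slexx/total_idem.
move=> h; apply: lt_y.
have L0 : \prod_i lam i <> 0 by exact: (prodQ_neq0 Q_canc Q1).
apply: (sle_cancel Q_canc L0).
have -> : (\prod_i lam i) * \prod_i y i = \prod_i (lam (sigma i) * y i).
  by rewrite big_split /=; congr (_ * _); rewrite (reindex_perm sigma).
apply: sle_trans (@sle_prod _ Q_total _ xpredT _ _ (fun i _ => By i)).
rewrite !big_split /= prodr_const card_ord exprMn.
by rewrite mulrA [_ * sig ^+ k]mulrC; apply: sle_mul2l.
Qed.

Lemma dominant_term_det : exists w, dominant_term w (\det ((monom u 1)%:M - A)).
Proof.
have [|w [wdom we]] := @dominant_term_prod u _ (index_enum 'I_k)
  (fun i => ((monom u 1)%:M - A) i i).
- move=> i; rewrite /dominant_term !mxE eqxx mulr1n addrAC subrr add0r gaussN.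
  move=> h; apply: rt; apply: (sle_cancel Q_canc (@lam0 i)).
  apply: sle_trans (A_le i i).
  by rewrite mulrA [lam i * _]mulrC; apply: sle_mul2l.
exists w; rewrite /determinant (bigD1 (1%g : 'S_k)) //= odd_perm1 mul1r.
under eq_bigr do rewrite perm1.
apply: dominant_termD => //.
have -> : chi w = chi u ^+ k.
  by rewrite we; congr (_ ^+ _); rewrite /index_enum -enumT size_enum_ord.
elim/big_rec: _ => [|sigma F sigma1 IH].
  rewrite /gauss trop0 // rmorph0 => /sle0_eq0.
  rewrite -[k in LHS]card_ord -prodr_const; apply: (prodQ_neq0 Q_canc Q1) => _ u0.
  by apply: rt; rewrite u0 mulr0; apply: sle0.
move=> h; have {h} := sle_trans h (gauss_add _ _); apply: (nsle_add Q_total) => //.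
rewrite mulr_sign; case: ifP => _; rewrite ?gaussN => h;
  by apply: (det_offdiag sigma1); apply: sle_trans h _; apply: gauss_prod.
Qed.

End Determinant.

Lemma semifield_mul_neq0 c d : c <> 0 -> d <> 0 -> c * d <> 0.
Proof.
have [_ inv] := S_field; move=> /inv[y cy] d0 cd; apply: d0.
by rewrite -[d]mul1r -cy mulrAC cd mul0r.
Qed.

Section Split.
Variables (a l : monalg S M).
Let k := size (msupp l).
Let w (i : 'I_k) : M := nth 0 (msupp l) i.

(** Each coefficient of [a * l] is attained by a single product [a_x l_y], so
    each term of [F] can be charged to one monomial of [l]. *)
Lemma split_bounded c F : c <> 0 -> sle (monom 0 c * trop v F) (a * l) ->
  exists E : 'I_k -> monalg K M, F = \sum_j E j * monom (w j) 1 /\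
    forall j, sle (monom 0 c * trop v (E j)) (monom 0 (mcoef l (w j)) * a).
Proof.
have [v0 vM v1 vD] := v_val.
move=> c0 Fal.
have /choice[E EP] : forall z : M, exists E : 'I_k -> monalg K M,
    monom z (mcoef F z) = \sum_j E j * monom (w j) 1 /\
    forall j, sle (monom 0 c * trop v (E j)) (monom 0 (mcoef l (w j)) * a).
  move=> z; have [->|/eqP Fz] := eqVneq (mcoef F z) 0.
    exists (fun=> 0); rewrite monom0; split=> [|j].
      by rewrite big1 // => j _; rewrite mul0r.
    by rewrite trop0 // mulr0; apply: sle0.
  have le_z : sle (c * v (mcoef F z)) (mcoef (a * l) z).
    by move/sle_mcoefP/(_ z): Fal; rewrite mcoef_scale mcoef_trop.
  have alz : mcoef (a * l) z <> 0.
    move=> alz; rewrite alz in le_z; have := sle0_eq0 le_z.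
    by apply: semifield_mul_neq0 => // /v0.
  have [x [y [xa yl zE alE]]] := mcoefM_attained S_total alz.
  have ly : (index y (msupp l) < k)%N by rewrite index_mem.
  pose j0 := Ordinal ly; have wj0 : w j0 = y by rewrite /w nth_index.
  exists (fun j => if j == j0 then monom x (mcoef F z) else 0).
  split=> [|j].
    rewrite (bigD1 j0) //= eqxx wj0 monomM mulr1 -zE big1 ?addr0 // => j.
    by move=> /negPf->; rewrite mul0r.
  case: eqP => [->|_]; last by rewrite trop0 // mulr0; apply: sle0.
  rewrite wj0 trop_monom // monomM add0r.
  apply: (@sle_trans _ (monom 0 (mcoef l y) * monom x (mcoef a x))).
    by rewrite monomM add0r; apply: sle_monom; rewrite [_ * mcoef a x]mulrC -alE.
  by apply/sle_mul2l/sle_term.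
exists (fun j => \sum_(t <- msupp F) E t j); split=> [|j].
  rewrite {1}(monalg_sum F).
  under [RHS]eq_bigr do rewrite mulr_suml.
  by rewrite exchange_big; apply: eq_bigr => z _; have [] := EP z.
apply: sle_trans (sle_mul2l _ (trop_sum idem v_val _ _)) _.
by rewrite mulr_sumr; apply: sle_sum => // z _; have [_] := EP z.
Qed.

End Split.

Hypothesis I_monom : forall q, prime_ideal q -> I `<=` q ->
  (forall q', prime_ideal q' -> I `<=` q' -> q' `<=` q -> q' = q) ->
  forall w, ~ q (monom w 1).

(** The elements with a dominant term form a multiplicative set that misses
    [I], so a minimal prime over [I] avoids them; it avoids the monomials as
    well. *)
Lemma dominant_term_no_zero_divisor u w F : dominant_term u F ->
  ~ I (F * monom w 1).
Proof.
move=> uF.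
have [||f [y yf]|q [q_prime Iq Dq _ q_min]] :=
    @minimal_prime _ I [set F | exists t, dominant_term t F] I_ideal.
- by exists 0; apply: dominant_term1.
- move=> f g [y yf] [z zg]; exists (y + z); exact: dominant_termM.
- exact: dominant_term_notin yf.
have [_ _ qP] := q_prime.
move=> /Iq/qP[|]; last exact: I_monom.
by apply: Dq; exists u.
Qed.

(** The determinant trick: [x l <= a l] becomes a linear system modulo [I] for
    the monomials of [l]. *)
Lemma bend_cancel a l x : l <> 0 -> Bend (trop_ideal v I) (x * l + a * l) (a * l) ->
  sle (phi x) (phi a).
Proof.
have [I0 ID IM] := I_ideal; have [v0 vM v1 vD] := v_val.
move=> l0 xl; apply: contrapT => nxa.
have theta0 c : c <> 0 -> phi (monom 0 c) <> 0.
  move=> c0; have [_ /(_ c c0)[d cd]] := S_field; move=> e; apply: Q1.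
  have <- : phi (monom 0 c) * phi (monom 0 d) = 1.
    by rewrite -rmorphM monomM addr0 cd -[RHS](rmorph1 phi).
  by rewrite e mul0r.
have [u [ux nua]] : exists u, u \in msupp x /\
    ~ sle (phi (monom u (mcoef x u))) (phi a).
  apply/not_existsP => h; apply: nxa.
  rewrite (monalg_sum x) rmorph_sum; apply: sle_sum => // u ux.
  by apply: contrapT => nua; apply: (h u).
have xu0 : mcoef x u <> 0 by move: ux; rewrite mem_msupp => /eqP.
pose k := size (msupp l); pose w (i : 'I_k) : M := nth 0 (msupp l) i.
have lw0 i : mcoef l (w i) <> 0.
  by apply/eqP; rewrite -mem_msupp mem_nth.
pose sig := phi (monom 0 (mcoef x u)); pose lam i := phi (monom 0 (mcoef l (w i))).
have /choice[E EP] : forall i, exists E : 'I_k -> monalg K M,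
    I (monom (u + w i) 1 - \sum_j E j * monom (w j) 1) /\
    forall j, sle (sig * lam i * gauss (E j)) (lam j * phi a).
  move=> i; have c0 := semifield_mul_neq0 xu0 (@lw0 i).
  have [G IG Gle] := bend_dominated idem v_val S_total addI I_ideal xl (u + w i).
  have [|E [GE Ele]] := @split_bounded a l _ G c0.
    apply: sle_trans Gle; apply/sle_mul2r/sle_monom; rewrite mcoefD.
    apply: sle_trans (sle_addl idem _ _); exact: sle_mcoefM.
  exists E; rewrite -GE; split=> // j.
  have := phi_le (Ele j); rewrite !rmorphM /=; apply: sle_trans.
  by rewrite -!rmorphM monomM addr0; exact/slexx/total_idem.
pose A : 'M[monalg K M]_k := \matrix_(i, j) E i j.
have [|||y ydom] := @dominant_term_det k A u sig (phi a) lam.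
- by move=> i; apply: theta0.
- by move: nua; rewrite /sig /chi -rmorphM monomM add0r mulr1.
- by move=> i j; rewrite mxE; have [_] := EP i.
pose C : 'cV[monalg K M]_k := \col_j monom (w j) 1.
have IAC i : I ((((monom u 1)%:M - A) *m C) i 0).
  have [+ _] := EP i; congr I.
  rewrite mulmxBl mul_scalar_mx !mxE monomM mulr1; congr (_ - _).
  by apply: eq_bigr => j _; rewrite !mxE.
have [i0 _] : exists i0 : 'I_k, true.
  have [l_0|/fset0Pn[z zl]] := eqVneq (msupp l) fset0.
    by case: l0; rewrite (monalg_sum l) l_0 big_seq_fset0.
  have lt_k : (index z (msupp l) < k)%N by rewrite index_mem.
  by exists (Ordinal lt_k).
apply: (@dominant_term_no_zero_divisor y (w i0) _ ydom).
have -> : \det ((monom u 1)%:M - A) * monom (w i0) 1 =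
    (\adj ((monom u 1)%:M - A) *m (((monom u 1)%:M - A) *m C)) i0 0.
  by rewrite mulmxA mul_adj_mx mul_scalar_mx !mxE.
rewrite mxE; elim/big_rec: _ => // i F _; apply: ID.
exact: IM.
Qed.

End PrimeReduction.

(** * The toric boundary and the conclusion *)

Lemma additive_inj_addI (M : nmodType) (n : nat)
    (iota : {additive M -> 'rV[int]_n}) :
  injective iota -> forall z : M, injective (+%R z : M -> M).
Proof.
move=> iI z x y /(congr1 iota); rewrite !raddfD => /addrI; exact: iI.
Qed.

(** The primes containing [q] form a component of the variety of [I], so one of
    them is contracted from the torus, where monomials are units. *)
Lemma minimal_prime_no_monomial (K : fieldType) (n : nat) (M : nmodType)
    (iota : {additive M -> 'rV[int]_n}) (I q : set (monalg K M)) (w : M) :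
  (forall Z, irreducible_component (zero_locus I) Z ->
     ~ (Z `<=` toric_boundary K iota)) ->
  prime_ideal q -> I `<=` q ->
  (forall q', prime_ideal q' -> I `<=` q' -> q' `<=` q -> q' = q) ->
  ~ q (monom w 1).
Proof.
move=> I_boundary q_prime Iq q_min qw.
pose Z := [set p : set (monalg K M) | Spec p /\ q `<=` p].
have qZ : Z q by split.
apply: (I_boundary Z).
  split.
  - by move=> p [p_prime qp]; split=> // F /Iq/qp.
  - split; first by exists q.
    move=> _ _ [J1 ->] [J2 ->] ZC; have [[_ Jq]|[_ Jq]] := ZC q qZ; [left|right];
    by move=> p [p_prime qp]; split=> // F /Jq/qp.
  - move=> Y YI [_ Yirr] ZY; apply/seteqP; split=> // p Yp; split.
      by have [] := YI p Yp.
    (* The intersection of the points of an irreducible set is a prime. *)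
    suff <- : [set F | forall p, Y p -> p F] = q by move=> F /(_ p Yp).
    apply: q_min.
    + split=> [|/(_ q (ZY q qZ))|F G FG]; first split.
      * by move=> p' /YI[[[]]].
      * move=> F G FY GY p' Yp'; have [[[_ pD _] _ _] _] := YI p' Yp'.
        by apply: (pD); [apply: FY|apply: GY].
      * move=> a F FY p' Yp'; have [[[_ _ pM] _ _] _] := YI p' Yp'.
        by apply: pM; apply: FY.
      * by have [_ q1 _] := q_prime.
      * have [||||] := Yirr (zero_locus [set F]) (zero_locus [set G]).
        -- by exists [set F].
        -- by exists [set G].
        -- move=> p' Yp'; have [p'_prime _] := YI p' Yp'.
           have [_ _ pP] := p'_prime; have [h|h] := pP _ _ (FG p' Yp').
             by left; split=> // _ ->.
           by right; split=> // _ ->.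
        -- by move=> h; left=> p' /h[_]; apply.
        -- by move=> h; right=> p' /h[_]; apply.
    + by move=> F IF p' /YI[_]; apply.
    + by move=> F; apply; apply: ZY.
move=> p [p_prime qp]; split=> // -[q' [[_ _ q'M] q'1 _] pE].
move: (qp _ qw); rewrite -pE /= /lattice_map.
have -> : msupp (monom w 1 : monalg K M) = [fset w]%fset.
  apply/fsetP => z; rewrite mem_msupp mcoef_monom inE.
  by case: (z =P w) => _; rewrite ?oner_eq0 ?eqxx.
rewrite big_seq_fset1 mcoef_monom eqxx => q'w; apply: q'1.
have := q'M (monom (- iota w) 1) _ q'w.
by rewrite monomM addNr mulr1.
Qed.

Lemma tropical_total (RR : realType) : totally_ordered (tropical RR).
Proof.
move=> [a|] [b|]; rewrite /sle /=; [|by right|by left|by left].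
by have [ab|/ltW ba] := leP a b; [left|right]; congr Some; apply/max_idPr.
Qed.

Lemma inj_total (S T : comPzSemiRingType) (j : {rmorphism S -> T}) :
  injective j -> totally_ordered T -> totally_ordered S.
Proof.
move=> jI T_total x y; have [h|h] := T_total (j x) (j y); [left|right];
  by apply: jI; rewrite rmorphD.
Qed.

Lemma loc_in_frac (R : comPzSemiRingType) (U : set R) (x d : R)
    (hd : denominator U d) :
  Defs.frac x hd * loc_in U d = loc_in U x.
Proof.
rewrite [LHS]loc_mulE; apply/fracP; exists 1; first exact: denominator1.
by rewrite !mulr1.
Qed.

(** [l] is the sum of the generators: being larger than each of them, it
    generates the same downward closed module, which is faithful, hence
    nonzero. *)
Lemma quasi_integral_bound (R : comPzSemiRingType) (A : set R) (x : R) :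
  (forall y : R, y + y = y) -> 1 <> 0 :> R -> subsemiring A ->
  quasi_integral A x -> exists l a, [/\ l <> 0, A a & sle (x * l) (a * l)].
Proof.
move=> idem R1 [A0 A1 AD AM] [N [L [[N0 ND NM] [[L0 LD LM] [s Ls]] LN NE Nf]]].
pose l := \sum_(y <- s) y.
have sL y : y \in s -> L y by move=> ys; rewrite Ls => L' _; apply.
have Ll : L l by rewrite /l big_seq; elim/big_rec: _ => // y z /sL Ly; apply: LD.
have Lle y : L y -> exists2 a, A a & sle y (a * l).
  rewrite Ls => /(_ [set y | exists2 a, A a & sle y (a * l)]); apply.
    split=> [|z t [a Aa za] [b Ab tb]|b z Ab [a Aa za]].
    - by exists 0; rewrite // mul0r; apply: slexx.
    - by exists (a + b); [apply: AD|rewrite mulrDl; apply: sle_add].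
    - by exists (b * a); [apply: AM|rewrite -mulrA; apply: sle_mul2l].
  by move=> z zs; exists 1 => //; rewrite mul1r; apply: sle_sumr.
have Nle y : N y -> exists2 a, A a & sle y (a * l).
  by rewrite NE => -[z /Lle[a Aa za] yz]; exists a => //; apply: sle_trans za.
have xN : N (x * l) by apply: NM; [move=> D _ _ _; apply|apply: LN].
have [a Aa xa] := Nle _ xN; exists l, a; split=> // l0; apply: R1.
apply: Nf => [D [] //|D [] //|y /Nle[b _]].
by rewrite l0 mulr0 => /sle0_eq0->; rewrite !mulr0.
Qed.

Theorem theorem1p5 (RR : realType)
  (S : comNzSemiRingType) (j : {rmorphism S -> tropical RR})
  (j_inj : injective j) (S_semifield : semifield S)
  (K : fieldType) (v : K -> S) (v_valuation : valuation v)
  (n : nat) (M : nmodType) (iota : {additive M -> 'rV[int]_n})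
  (M_toric : toric_embedding RR iota)
  (I : set (monalg K M)) (I_ideal : ideal I)
  (I_boundary : forall Z : set (set (monalg K M)),
     irreducible_component (zero_locus I) Z ->
     ~ (Z `<=` toric_boundary K iota))
  (U : set (bend_quotient v I))
  (U_cancellative : forall u : bend_quotient v I, U u -> cancellative_elt u)
  (A : set (localization U)) (A_subsemiring : subsemiring A) :
  valuative_closure A = quasi_integral_closure A.
Proof.
have S_total : totally_ordered S := inj_total j_inj (@tropical_total RR).
have S_idem (c : S) : c + c = c by have [h|h] := S_total c c.
have T_idem (f : bend_quotient v I) : f + f = f.
  by rewrite -(quot_piK f) -rmorphD monalg_idem.
have R_idem (y : localization U) : y + y = y.
  have -> : y + y = y * loc_in U (1 + 1) by rewrite rmorphD rmorph1 mulrDr mulr1.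
  by rewrite T_idem rmorph1 mulr1.
apply/seteqP; split; first exact: valuative_sub_quasi_integral.
move=> x xA P P_prime AP; have [P_proper Q_total Q_canc] := P_prime.
pose rho : {rmorphism localization U -> Defs.quotient P} := quot_pi P.
have Q1 : 1 <> 0 :> Defs.quotient P.
  move=> e; apply: P_proper => y z; apply/quot_piP.
  by rewrite -[quot_pi P y]mulr1 -[quot_pi P z]mulr1 e !mulr0.
have [|l [a [l0 Aa xl]]] := quasi_integral_bound R_idem _ A_subsemiring xA.
  by move=> e; apply: Q1; rewrite -(rmorph1 rho) e rmorph0.
have rho_a : sle (rho a) 1 by apply/valuation_subsemiringP/AP.
apply/valuation_subsemiringP; apply: sle_trans rho_a.
pose phi : {rmorphism monalg S M -> Defs.quotient P} :=
  rho \o loc_in U \o quot_pi (Bend (trop_ideal v I)).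
have phi_bend f g : Bend (trop_ideal v I) f g -> phi f = phi g.
  by move=> /quot_piP fg; rewrite /phi /= fg.
have rho_den d : denominator U d -> rho (loc_in U d) <> 0.
  move=> hd e; apply: Q1; rewrite -(rmorph1 rho).
  have <- : Defs.frac 1 hd * loc_in U d = 1 by rewrite loc_in_frac rmorph1.
  by rewrite rmorphM e mulr0.
have [x' [d [hd xE]]] := frac_surj x; have [a' [e [he aE]]] := frac_surj a.
have [l' [c [hc lE]]] := frac_surj l.
have key : x' * e * l' + a' * d * l' = a' * d * l'.
  have : loc_in U (x' * e * l' + a' * d * l') = loc_in U (a' * d * l').
    rewrite rmorphD !rmorphM /= -(loc_in_frac x' hd) -(loc_in_frac a' he).
    rewrite -(loc_in_frac l' hc) -xE -aE -lE.
    set D := loc_in U d; set E := loc_in U e; set C := loc_in U c.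
    have -> : x * D * E * (l * C) + a * E * D * (l * C) =
        (x * l + a * l) * (D * E * C).
      by ring.
    by rewrite [x * l + _]xl; ring.
  by move/(frac_cancelP _ _ _ _ U_cancellative); rewrite !mulr1.
have l'0 : repr l' <> 0.
  move=> l'0; apply: l0; rewrite lE -(quot_piK l') l'0 rmorph0.
  by apply/fracP; exists 1; [apply: denominator1|rewrite !mul0r].
have bend_key : Bend (trop_ideal v I)
    (repr (x' * e) * repr l' + repr (a' * d) * repr l')
    (repr (a' * d) * repr l').
  by apply/quot_piP; rewrite rmorphD !rmorphM /= !quot_piK.
have := bend_cancel S_idem v_valuation S_total S_semifield
  (additive_inj_addI M_toric.1) I_ideal (phi := phi) Q_total Q_canc Q1 phi_bend
  (fun q qp Iq qm w => minimal_prime_no_monomial I_boundary qp Iq qm) l'0 bend_key.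
rewrite /phi /= !quot_piK !rmorphM /=.
rewrite -(loc_in_frac x' hd) -(loc_in_frac a' he) -xE -aE !rmorphM /=.
have DE0 : rho (loc_in U d) * rho (loc_in U e) <> 0.
  by rewrite -!rmorphM; apply: rho_den; apply: denominatorM.
move=> h; apply: (sle_cancel Q_canc DE0); move: h; congr sle; ring.
Qed.
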